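(* Let $\tau>0$. Under the first-order correlation model, the SINR coverage probability of the typical user in the 2D network is $$\mathrm{p_c}(\tau)=\sum_{s\in\{\mathsf L,\mathsf N\}}\int_0^\infty 2\pi\lambda\,e^{-\tau\sigma_n^2/\ell_s(r)}\,\kappa_{\mathsf L|s}(r,\tau)\,\kappa_{\mathsf N|s}(r,\tau)\,g_s(r)\,r\,dr,$$ where for $s,v\in\{\mathsf L,\mathsf N\}$ $$\kappa_{v|s}(r,\tau)=\exp\Big(-\int_{e_{v|s}(r)}^\infty\frac{\lambda}{1+\tau^{-1}\frac{\ell_s(r)}{\ell_v(t)}}\Big(\int_0^{2\pi}\frac{p_{s,v}(r,t,\theta)}{p_s(r)}\,d\theta\Big)t\,dt\Big),$$ $$g_{\mathsf L}(x)=p_{\mathsf L}(x)\exp\Big(-\lambda\int_0^{2\pi}\int_0^{x}\frac{p_{\mathsf L,\mathsf L}(x,t,\theta)}{p_{\mathsf L}(x)}t\,dt\,d\theta-\lambda\int_0^{2\pi}\int_0^{e_{\mathsf N|\mathsf L}(x)}\frac{p_{\mathsf L,\mathsf N}(x,t,\theta)}{p_{\mathsf L}(x)}t\,dt\,d\theta\Big),$$ $$g_{\mathsf N}(x)=p_{\mathsf N}(x)\exp\Big(-\lambda\int_0^{2\pi}\int_0^{e_{\mathsf L|\mathsf N}(x)}\frac{p_{\mathsf N,\mathsf L}(x,t,\theta)}{p_{\mathsf N}(x)}t\,dt\,d\theta-\lambda\int_0^{2\pi}\int_0^{x}\frac{p_{\mathsf N,\mathsf N}(x,t,\theta)}{p_{\mathsf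 N}(x)}t\,dt\,d\theta\Big).$$
   Context: 2D network. Base stations (BSs) form a homogeneous Poisson point process (PPP) of density $\lambda>0$ on $\mathbb R^2$; the typical user is at the origin. Blockages form an independent Boolean model of line segments: centers form a homogeneous PPP of density $\mu>0$, with i.i.d. random lengths $L$ ($0<\mathbb E[L]<\infty$) and independent orientations uniform on $[0,\pi]$; $\beta=2\mu\mathbb E[L]/\pi$. A link is the segment from the origin to a BS; it is LoS (type $\mathsf L$) if no blockage intersects it and NLoS (type $\mathsf N$) otherwise. A link of length $r$ is LoS with probability $p_{\mathsf L}(r)=e^{-\beta r}$ and NLoS with probability $p_{\mathsf N}(r)=1-e^{-\beta r}$. For two links of lengths $r_1,r_2$ with directions differing by $\theta\in[0,2\pi]$, $p_{s,v}(r_1,r_2,\theta)$ is the probability that the first is of type $s$ and the second of type $v$; thus $p_{\mathsf L,\mathsf L}$ is the probability that no blockage intersects either link, $p_{\mathsf L,\mathsf N}=e^{-\beta r_1}-p_{\mathsf L,\mathsf L}$, $p_{\mathsf N,\mathsf L}=e^{-\beta r_2}-p_{\mathsf L,\mathsf L}$, $p_{\mathsf N,\mathsf N}=1-e^{-\beta r_1}-e^{-\beta r_2}+p_{\mathsf L,\mathsf L}$. Path loss: $\ell_{\mathsf L},\ell_{\mathsf N}:[0,\infty)\to[0,\infty)$ are bounded and nonincreasing with $\ell_{\mathsf L}\ge\ell_{\mathsf N}$. A BS of type $v$ at distance $t$ gives received power $H\ell_v(t)$, with fading $H$ i.i.d. exponential of mean $1$, independent of everything else. Exclusion radii: $e_{\mathsf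 L|\mathsf L}(x)=e_{\mathsf N|\mathsf N}(x)=x$, $e_{\mathsf N|\mathsf L}(x)=\min\{y\ge0:\ell_{\mathsf N}(y)\le\ell_{\mathsf L}(x)\}$, $e_{\mathsf L|\mathsf N}(x)=\min\{y\ge0:\ell_{\mathsf L}(y)\le\ell_{\mathsf N}(x)\}$ (min read as infimum, $\infty$ if the set is empty). A BS of type $s$ at distance $x$ is serving iff every other BS of type $v$ is at distance greater than $e_{v|s}(x)$, for $v\in\{\mathsf L,\mathsf N\}$. When a BS of type $s$ at distance $r$ with fading $H_0$ is serving, $\mathsf{SINR}=H_0\ell_s(r)/(\sigma_n^2+I)$, where $\sigma_n^2>0$ is the noise power and $I$ is the sum of received powers of all other BSs. First-order correlation model: for $r>0$, let $Q_r$ be the law in which there is a given BS at distance $r$, of type $s$ with probability $p_s(r)$; given that it is of type $s$, the other BSs form a PPP of density $\lambda$ and their types are mutually independent, a BS at distance $t$ whose direction makes angle $\theta$ with that of the given BS having type $v$ with probability $p_{s,v}(r,t,\theta)/p_s(r)$. Let $E_{s,r}$ be the event that the given BS is of type $s$ and is serving. In the first-order model the Palm distribution given a BS at distance $r$ is taken to be $Q_r$, so $\mathrm{p_c}(\tau)=\mathbb P[\mathsf{SINR}>\tau]$ is $\mathrm{p_c}(\tau)=\sum_s 2\pi\lambda\int_0^\infty Q_r[E_{s,r},\ \mathsf{SINR}>\tau]\,r\,dr$. Conventions: $1/(1+\tau^{-1}a/b)=0$ when $b=0$, and the integrand containing $e^{-\tau\sigma_n^2/\ell_s(r)}$ is $0$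 when $\ell_s(r)=0$. *)

(* Defs.v *)
(* MathComp-Analysis, over an arbitrary [R : realType]. *)
From HB Require Import structures.
From mathcomp Require Import all_boot all_order all_algebra.
From mathcomp Require Import all_classical all_reals all_analysis.
Set Implicit Arguments.
Unset Strict Implicit.
Unset Printing Implicit Defensive.
Import Order.TTheory GRing.Theory Num.Theory.
Import numFieldNormedType.Exports.
Local Open Scope classical_set_scope.
Local Open Scope ring_scope.

(** * The plane *)

Notation plane R := (measurableTypeR R * measurableTypeR R)%type.

Definition area (R : realType) : set (plane R) -> \bar R :=
  (@lebesgue_measure R \x @lebesgue_measure R)%E.

Definition enorm (R : realType) (x : plane R) : R :=
  Num.sqrt (x.1 ^+ 2 + x.2 ^+ 2).

(* The polar angle, in [0, 2 pi). *)
Definition polar_angle (R : realType) (x : plane R) : R :=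
  if 0 <= x.2 then acos (x.1 / enorm x) else 2 * pi - acos (x.1 / enorm x).

(* The counterclockwise angle from the direction of y to that of x. *)
Definition angle (R : realType) (y x : plane R) : R :=
  let d := polar_angle x - polar_angle y in
  if 0 <= d then d else d + 2 * pi.

Definition polar (R : realType) (r theta : R) : plane R :=
  (r * cos theta, r * sin theta).

(** * Point processes *)

(* A point process is given by a measurable enumeration of its points; a
   homogeneous process of positive density on the plane a.s. has infinitely
   many points, so indexing by nat loses nothing. *)
Definition npoints (R : realType) (T : Type) (X : nat -> T -> plane R)
    (A : set (plane R)) (w : T) : \bar R :=
  (\sum_(0 <= i <oo) (\1_A (X i w))%:E)%E.

(* [Pr] is the law under which the process is considered: a probability
   measure or a conditional probability. *)
Definition is_PPP (R : realType) (T : Type) (Pr : set T -> R) (density : R)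
    (X : nat -> T -> plane R) : Prop :=
  (forall (A : set (plane R)) (k : nat), measurable A -> (area A < +oo)%E ->
     let m := density * fine (area A) in
     Pr [set w | npoints X A w = k%:R%:E] = expR (- m) * m ^+ k / k`!%:R) /\
  (forall (n : nat) (A : nat -> set (plane R)) (k : nat -> nat),
     (forall i, (i < n)%N -> measurable (A i) /\ (area (A i) < +oo)%E) ->
     trivIset `I_n A ->
     Pr [set w | forall i, (i < n)%N -> npoints X (A i) w = (k i)%:R%:E] =
     \prod_(i < n) Pr [set w | npoints X (A i) w = (k i)%:R%:E]).

(* Generators of the sigma-algebra of a sequence of random points. *)
Definition gen_events (R : realType) (T : Type) (X : nat -> T -> plane R) :
    set (set T) :=
  [set E | exists i A, measurable A /\ E = X i @^-1` A].

(** * The blockages *)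

Record segment_process (R : realType) := SegmentProcess {
  sp_disp : measure_display ;
  sp_space : measurableType sp_disp ;
  sp_prob : probability sp_space R ;
  sp_center : nat -> sp_space -> plane R ;
  sp_length : nat -> sp_space -> R ;
  sp_orient : nat -> sp_space -> R
}.
Arguments sp_center {R} s j w.
Arguments sp_length {R} s j w.
Arguments sp_orient {R} s j w.

(* Boolean model of segments: Poisson centers of density [mu], and marks
   independent of each other and of the centers, with lengths of law [nu] and
   orientations uniform on [0, pi]. *)
Record is_boolean_model (R : realType) (mu : R)
    (nu : probability (measurableTypeR R) R) (B : segment_process R) : Prop := {
  bm_meas_center : forall j, measurable_fun setT (sp_center B j) ;
  bm_meas_length : forall j, measurable_fun setT (sp_length B j) ;
  bm_meas_orient : forall j, measurable_fun setT (sp_orient B j) ;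
  bm_length_ge0 : forall j w, 0 <= sp_length B j w ;
  bm_center : is_PPP (fun E => fine (sp_prob B E)) mu (sp_center B) ;
  bm_marks : forall (n : nat) (E : set (sp_space B))
      (U V : nat -> set (measurableTypeR R)),
    <<s gen_events (sp_center B) >> E ->
    (forall j, measurable (U j)) -> (forall j, measurable (V j)) ->
    (sp_prob B (E `&` [set w | forall j, (j < n)%N ->
                         U j (sp_length B j w) /\ V j (sp_orient B j w)]) =
     sp_prob B E *
       \prod_(j < n) (nu (U j) * uniform_prob (pi_gt0 R) (V j)))%E
}.

Definition blockage (R : realType) (B : segment_process R) (j : nat)
    (w : sp_space B) : set (plane R) :=
  [set z | exists2 u : R, `|u| <= sp_length B j w / 2 &
     z = ((sp_center B j w).1 + u * cos (sp_orient B j w),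
          (sp_center B j w).2 + u * sin (sp_orient B j w))].
Arguments blockage {R} B j w.

Definition link (R : realType) (x : plane R) : set (plane R) :=
  [set z | exists2 u : R, 0 <= u <= 1 & z = (u * x.1, u * x.2)].

Inductive ltype := LoS | NLoS.

Definition is_los (R : realType) (B : segment_process R) (x : plane R)
    (w : sp_space B) : Prop :=
  forall j, link x `&` blockage B j w = set0.
Arguments is_los {R} B x w.

Definition has_type (R : realType) (B : segment_process R) (s : ltype)
    (x : plane R) (w : sp_space B) : Prop :=
  match s with LoS => is_los B x w | NLoS => ~ is_los B x w end.
Arguments has_type {R} B s x w.

Definition blockage_beta (R : realType) (mu : R)
    (nu : probability (measurableTypeR R) R) : R :=
  2 * mu * fine (\int[nu]_l l%:E)%E / pi.

Definition p_type (R : realType) (beta : R) (s : ltype) (r : R) : R :=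
  match s with
  | LoS => expR (- (beta * r))
  | NLoS => 1 - expR (- (beta * r))
  end.

(* The Boolean model is isotropic, so the first link may be laid along the
   first axis. *)
Definition p_joint (R : realType) (B : segment_process R) (s v : ltype)
    (r1 r2 theta : R) : R :=
  fine (sp_prob B [set w | has_type B s (polar r1 0) w /\
                           has_type B v (polar r2 theta) w]).

(** * Path loss and exclusion radii *)

Record is_path_loss (R : realType) (ell : ltype -> R -> R) : Prop := {
  pl_ge0 : forall v t, 0 <= t -> 0 <= ell v t ;
  pl_bounded : forall v, exists M, forall t, 0 <= t -> ell v t <= M ;
  pl_nonincreasing : forall v t t', 0 <= t -> t <= t' -> ell v t' <= ell v t ;
  pl_los_nlos : forall t, 0 <= t -> ell NLoS t <= ell LoS t
}.

(* [excl ell v s x] is e_{v|s}(x). *)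
Definition excl (R : realType) (ell : ltype -> R -> R) (v s : ltype) (x : R) :
    \bar R :=
  match v, s with
  | LoS, LoS | NLoS, NLoS => x%:E
  | _, _ => ereal_inf [set y%:E | y in [set y | 0 <= y /\ ell v y <= ell s x]]
  end.

(** * The network seen from the user, given a base station at distance r *)

Record bs_network (R : realType) := BSNetwork {
  bs_disp : measure_display ;
  bs_space : measurableType bs_disp ;
  bs_prob : probability bs_space R ;
  given_pos : plane R ;
  given_type : bs_space -> ltype ;
  given_fading : bs_space -> R ;
  other_pos : nat -> bs_space -> plane R ;
  other_type : nat -> bs_space -> ltype ;
  other_fading : nat -> bs_space -> R
}.
Arguments given_type {R} b w.
Arguments given_fading {R} b w.
Arguments other_pos {R} b i w.
Arguments other_type {R} b i w.
Arguments other_fading {R} b i w.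

Definition cond_prob (R : realType) (d : measure_display)
    (T : measurableType d) (P : probability T R) (E A : set T) : R :=
  fine (P (A `&` E)) / fine (P E).

(* Generators of the sigma-algebra of the types and positions. *)
Definition type_pos_events (R : realType) (N : bs_network R) :
    set (set (bs_space N)) :=
  gen_events (other_pos N) `|`
  [set E | exists s, E = [set w | given_type N w = s]] `|`
  [set E | exists i v, E = [set w | other_type N i w = v]].
Arguments type_pos_events {R} N _.

(* [N] has the law Q_r. [fo_other_type] states that, given the type s of the
   given base station and the positions of the others, the types of the others
   are independent with the prescribed probabilities. *)
Record first_order_law (R : realType) (lambda beta : R)
    (B : segment_process R) (r : R) (N : bs_network R) : Prop := {
  fo_given_pos : enorm (given_pos N) = r ;
  fo_meas_given_type : forall s, measurable [set w | given_type N w = s] ;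
  fo_meas_given_fading : measurable_fun setT (given_fading N) ;
  fo_meas_pos : forall i, measurable_fun setT (other_pos N i) ;
  fo_meas_type : forall i v,
    measurable [set w | other_type N i w = v] ;
  fo_meas_fading : forall i, measurable_fun setT (other_fading N i) ;
  fo_given_fading_ge0 : forall w, 0 <= given_fading N w ;
  fo_fading_ge0 : forall i w, 0 <= other_fading N i w ;
  fo_given_type : forall s,
    bs_prob N [set w | given_type N w = s] = (p_type beta s r)%:E ;
  fo_other_pos : forall s,
    is_PPP (cond_prob (bs_prob N) [set w | given_type N w = s]) lambda
      (other_pos N) ;
  fo_other_type : forall (s : ltype) (n : nat) (v : nat -> ltype)
      (E : set (bs_space N)),
    <<s gen_events (other_pos N) >> E ->
    bs_prob N (E `&` [set w | given_type N w = s] `&`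
               [set w | forall i, (i < n)%N -> other_type N i w = v i]) =
    (\int[bs_prob N]_(w in E `&` [set w | given_type N w = s])
       (\prod_(i < n)
          (p_joint B s (v i) r (enorm (other_pos N i w))
             (angle (given_pos N) (other_pos N i w)) / p_type beta s r))%:E)%E ;
  fo_fading : forall (n : nat) (E : set (bs_space N))
      (U0 : set (measurableTypeR R)) (U : nat -> set (measurableTypeR R)),
    <<s type_pos_events N >> E ->
    measurable U0 -> (forall i, measurable (U i)) ->
    (bs_prob N (E `&` [set w | U0 (given_fading N w)] `&`
                [set w | forall i, (i < n)%N -> U i (other_fading N i w)]) =
     bs_prob N E * exponential_prob 1 U0 *
       \prod_(i < n) exponential_prob 1 (U i))%E
}.

Definition serving (R : realType) (ell : ltype -> R -> R) (N : bs_network R)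
    (w : bs_space N) : Prop :=
  forall i, (excl ell (other_type N i w) (given_type N w) (enorm (given_pos N)) <
             (enorm (other_pos N i w))%:E)%E.
Arguments serving {R} ell N w.

(* Extended-valued: the sum may diverge when ell is not integrable, in which
   case the SINR is 0. *)
Definition interference (R : realType) (ell : ltype -> R -> R)
    (N : bs_network R) (w : bs_space N) : \bar R :=
  (\sum_(0 <= i <oo)
     (other_fading N i w * ell (other_type N i w) (enorm (other_pos N i w)))%:E)%E.
Arguments interference {R} ell N w.

Definition SINR (R : realType) (ell : ltype -> R -> R) (noise : R)
    (N : bs_network R) (w : bs_space N) : \bar R :=
  ((given_fading N w * ell (given_type N w) (enorm (given_pos N)))%:E /
   (noise%:E + interference ell N w))%E.
Arguments SINR {R} ell noise N w.

(* [Q r] is a network with the law Q_r. *)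
Definition coverage (R : realType) (lambda noise : R) (ell : ltype -> R -> R)
    (Q : R -> bs_network R) (tau : R) : \bar R :=
  (\sum_(s <- [:: LoS; NLoS])
     (2 * pi * lambda)%:E *
     \int[@lebesgue_measure R]_(r in `]0%R, +oo[)
       (bs_prob (Q r)
          [set w | [/\ given_type (Q r) w = s, serving ell (Q r) w &
                       tau%:E < SINR ell noise (Q r) w]] * r%:E))%E.

(** * The quantities of the closed formula *)

(* 1 / (1 + tau^-1 a / b), with value 0 when b = 0. *)
Definition sir_factor (R : realType) (tau a b : R) : R :=
  if b == 0 then 0 else 1 / (1 + tau^-1 * (a / b)).

(* exp (- tau noise / l), with value 0 when l = 0. *)
Definition noise_factor (R : realType) (tau noise l : R) : R :=
  if l == 0 then 0 else expR (- (tau * noise / l)).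

(* [kappa .. v s r] is kappa_{v|s}(r, tau). *)
Definition kappa (R : realType) (lambda beta : R) (B : segment_process R)
    (ell : ltype -> R -> R) (tau : R) (v s : ltype) (r : R) : \bar R :=
  expeR (- \int[@lebesgue_measure R]_(t in [set t | excl ell v s r <= t%:E])
             ((lambda * sir_factor tau (ell s r) (ell v t))%:E *
              (\int[@lebesgue_measure R]_(theta in `[0%R, (2 * pi)%R])
                 (p_joint B s v r t theta / p_type beta s r)%:E) *
              t%:E))%E.

(* The mean number of base stations of type v inside the exclusion radius
   e_{v|s}(x). *)
Definition excl_mean (R : realType) (lambda beta : R) (B : segment_process R)
    (ell : ltype -> R -> R) (v s : ltype) (x : R) : \bar R :=
  (lambda%:E *
   \int[@lebesgue_measure R]_(theta in `[0%R, (2 * pi)%R])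
     \int[@lebesgue_measure R]_(t in [set t | 0 <= t%:E <= excl ell v s x])
       (p_joint B s v x t theta / p_type beta s x * t)%:E)%E.

(* [serving_g .. s x] is g_s(x). *)
Definition serving_g (R : realType) (lambda beta : R) (B : segment_process R)
    (ell : ltype -> R -> R) (s : ltype) (x : R) : \bar R :=
  ((p_type beta s x)%:E *
   expeR (- excl_mean lambda beta B ell LoS s x
          - excl_mean lambda beta B ell NLoS s x))%E.

(* Main.v *)
(** Fix a given base station of type [s] at distance [r] and put
    [c = tau / ell s r].  Serving with SINR above [tau] means that every other
    station lies outside its exclusion radius and that the fading [H0] exceeds
    [c (noise + I)].  Conditionally on types and positions, integrating out the
    exponential fadings leaves [exp (- c noise)] times a product over the other
    stations of factors [1 / (1 + c ell)] or [0]; averaging their independent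
    types turns this into [\prod_i F (X i)] for one function [F] of position, and
    the generating functional of the Poisson process gives
    [exp (- lambda \int (1 - F))].  In polar coordinates around the given station
    [1 - F] splits, for each type, into the mass of the excluded region (the
    factor [g_s]) and a Laplace term outside it (the factor [kappa]).
    Only finitely many stations are handled at a time, so the strict inequality
    on the SINR is approached through the noise levels [noise + 1 / (m + 1)]. *)
Require Import Defs.
From HB Require Import structures.
From mathcomp Require Import all_boot all_order all_algebra.
From mathcomp Require Import all_classical all_reals all_analysis.
From mathcomp Require Import finmap measurable_realfun ring lra.
Set Implicit Arguments.
Unset Strict Implicit.
Unset Printing Implicit Defensive.
Import Order.TTheory GRing.Theory Num.Theory.
Import numFieldNormedType.Exports.
Local Open Scope classical_set_scope.
Local Open Scope ring_scope.

Import HBNNSimple.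

(** No conditional expectation given a sigma-algebra is formed. Conditioning on positions and types
    is done by integrating functions measurable for the sigma-algebra generated by a family [G],
    carried by [g_sigma_algebraType G]: independence becomes a product measure, and a conditional
    probability becomes a density. The price is measurability: the probability that a link ending at
    [z] has a given type must be a measurable function of [z], which is why line of sight is first
    described by explicit inequalities, jointly in the end of the link and the outcome. The points
    come in an arbitrary enumeration, so a product over all stations is a limit of products over the
    first [n], whereas the Poisson law speaks only of counts in sets of finite area; the generating
    functional reconciles the two by sandwiching. The integral of [1 - F] may be infinite, hence the
    extended exponential [expeR]. *)

(** * Integration over sub-sigma-algebras *)

(** A nonnegative simple function is a finite sum of scaled indicators of its level sets, and every
    nonnegative measurable function is an increasing limit of simple ones. *)
Lemma ge0_measurable_ind d (T : measurableType d) (R : realType)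
    (P : (T -> \bar R) -> Prop) :
  (forall A, measurable A -> P (EFin \o \1_A)) ->
  (forall f g : T -> \bar R, measurable_fun setT f -> measurable_fun setT g ->
    (forall x, 0 <= f x)%E -> (forall x, 0 <= g x)%E ->
    P f -> P g -> P (f \+ g)%E) ->
  (forall (k : R) (f : T -> \bar R), 0 <= k -> measurable_fun setT f ->
    (forall x, 0 <= f x)%E -> P f -> P (fun x => k%:E * f x)%E) ->
  (forall f : nat -> T -> \bar R, (forall n, measurable_fun setT (f n)) ->
    (forall n x, 0 <= f n x)%E ->
    (forall x, {homo f^~ x : n m / (n <= m)%N >-> (n <= m)%E}) ->
    (forall n, P (f n)) -> P (fun x => limn (f^~ x))) ->
  forall f : T -> \bar R, measurable_fun setT f -> (forall x, 0 <= f x)%E -> P f.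
Proof.
move=> Pind Padd Pscale Plim f mf f0.
have Psimple (g : {nnsfun T >-> R}) : P (EFin \o g).
  pose s : seq R := enum_fset (fset_set (g @` setT)).
  pose h y x : \bar R := (y%:E * (\1_(g @^-1` [set y]) x)%:E)%E.
  have -> : EFin \o g = fun x => (\sum_(y <- s) h y x)%E.
    apply/funext => x /=; rewrite [in LHS]fimfunEord -sumEFin.
    by rewrite [RHS](big_nth 0)/= big_mkord; apply: eq_bigr => i _; rewrite EFinM.
  have s0 y : y \in s -> 0 <= y.
    move=> ys; have : y \in fset_set (g @` setT) by [].
    by rewrite in_fset_set//; move/set_mem => [x _ <-].
  have mA r : measurable (g @^-1` [set r]).
    by rewrite -[X in measurable X]setTI; exact: measurable_funP.
  have mh y : measurable_fun setT (h y).
    by apply: measurable_funeM; apply/measurable_EFinP; exact: measurable_indic.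
  have h0 y x : y \in s -> (0 <= h y x)%E.
    by move=> ys; rewrite mule_ge0// lee_fin ?s0.
  have Ph y : y \in s -> P (h y).
    move=> ys; apply: (Pscale y (EFin \o \1_(g @^-1` [set y]))); rewrite ?s0//.
    - by apply/measurable_EFinP; exact: measurable_indic.
    - by move=> x /=; rewrite lee_fin.
    - exact: Pind.
  elim: s s0 h0 Ph => [|y s IH] s0 h0 Ph.
    (* The zero function, needed for the empty sum, is obtained as the indicator of the empty
       set. *)
    have := Pind set0 measurable0; congr P; apply/funext => x.
    by rewrite big_nil/= indic0.
  have -> : (fun x => \sum_(z <- y :: s) h z x)%E = (h y \+ fun x => \sum_(z <- s) h z x)%E.
    by apply/funext => x; rewrite big_cons.
  have ys z : z \in s -> z \in y :: s by rewrite inE => ->; rewrite orbT.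
  apply: Padd => //.
  - by apply: emeasurable_sum => // z; exact: mh.
  - by move=> x; rewrite h0// mem_head.
  - by move=> x; rewrite big_seq sume_ge0// => z zs; rewrite h0// ys.
  - by apply: Ph; rewrite mem_head.
  - apply: IH => [z zs|z x zs|z zs]; [exact/s0/ys|exact/h0/ys|exact/Ph/ys].
pose g := nnsfun_approx measurableT mf.
have gf : f = fun x => limn (fun n => (g n x)%:E).
  by apply/funext => x; apply/esym/cvg_lim => //; exact: cvg_nnsfun_approx.
rewrite gf; apply: (Plim (fun n => EFin \o g n)) => //.
- by move=> n; apply/measurable_EFinP; exact: measurable_funP.
- by move=> n x /=; rewrite lee_fin.
- by move=> x n m nm /=; rewrite lee_fin; exact/lefP/nd_nnsfun_approx.
Qed.

Section density_measure.
Context d (T : measurableType d) (R : realType) (mu : {measure set T -> \bar R}).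
Variable (q : T -> R).
Hypothesis mq : measurable_fun setT q.
Hypothesis q0 : forall x, 0 <= q x.

Definition density_measure (A : set T) : \bar R := (\int[mu]_(x in A) (q x)%:E)%E.

Let q0E x : (0 <= (q x)%:E)%E.
Proof. by rewrite lee_fin. Qed.

Let mqE : measurable_fun setT (EFin \o q).
Proof. exact/measurable_EFinP. Qed.

Let density_measure0 : density_measure set0 = 0%E.
Proof. by rewrite /density_measure integral_set0. Qed.

Let density_measure_ge0 A : (0 <= density_measure A)%E.
Proof. by apply: integral_ge0. Qed.

Let density_measure_sigma_additive : semi_sigma_additive density_measure.
Proof.
move=> /= F mF tF mUF; rewrite /density_measure; apply: cvg_toP.
  apply: ereal_nondecreasing_is_cvgn => m n mn.
  by apply: lee_sum_nneg_natr => // k _ _; exact: integral_ge0.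
by rewrite ge0_integral_bigcup//=; exact: measurable_funTS.
Qed.

HB.instance Definition _ := isMeasure.Build _ _ _ density_measure
  density_measure0 density_measure_ge0 density_measure_sigma_additive.

Lemma integral_density_measure (f : T -> \bar R) :
  measurable_fun setT f -> (forall x, 0 <= f x)%E ->
  (\int[density_measure]_x f x = \int[mu]_x (f x * (q x)%:E))%E.
Proof.
move: f; apply: (@ge0_measurable_ind _ _ _ (fun f =>
  \int[density_measure]_x f x = \int[mu]_x (f x * (q x)%:E))%E) => [A mA|f1 f2 mf1 mf2 f10 f20 h1 h2|k f1 k0 mf1 f10 h1|fs mfs fs0 fsnd h].
- rewrite integral_indic// setIT [LHS]integral_mkcond.
  apply: eq_integral => x _; rewrite patchE/= indicE.
  by case: ifPn => _; rewrite ?mul1e ?mul0e.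
- rewrite ge0_integralD//= h1 h2 -ge0_integralD//=.
  + by apply: eq_integral => x _; rewrite ge0_muleDl.
  + by move=> x _; rewrite mule_ge0.
  + exact: emeasurable_funM.
  + by move=> x _; rewrite mule_ge0.
  + exact: emeasurable_funM.
- rewrite ge0_integralZl_EFin//= h1 -ge0_integralZl_EFin//=.
  + by apply: eq_integral => x _; rewrite muleA.
  + by move=> x _; rewrite mule_ge0.
  + exact: emeasurable_funM.
- rewrite monotone_convergence//.
  rewrite (_ : (fun n => _) = fun n => \int[mu]_x (fs n x * (q x)%:E)%E)%E; last first.
    by apply/funext => n; exact: h.
  rewrite -monotone_convergence//.
  + apply: eq_integral => x _.
    rewrite -limeMr//.
    exact: ereal_nondecreasing_is_cvgn.
  + by move=> n; exact: emeasurable_funM.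
  + by move=> n x _; rewrite mule_ge0.
  + by move=> x _ n m nm; rewrite lee_wpmul2r// fsnd.
Qed.

End density_measure.

(** The identity towards the coarser sigma-algebra is the map along which measures are pushed
    forward, so that two of them need only be compared on events generated by [G]. *)
Lemma measurable_g_sigma d (T : measurableType d) (G : set (set T)) :
  G `<=` measurable -> measurable_fun setT (id : T -> g_sigma_algebraType G).
Proof.
move=> Gm _ A mA; rewrite setTI preimage_id.
by move: A mA; apply: smallest_sub => //; exact: sigma_algebra_measurable.
Qed.

Section g_sigma_integrals.
Context d (T : measurableType d) (R : realType) (P : probability T R).
Context (G : set (set T)) (Gm : G `<=` measurable).
Let G_measurable E : <<s G >> E -> measurable E.
Proof.
move: E; apply: smallest_sub => //; exact: sigma_algebra_measurable.
Qed.

(** Under the hypothesis the law of the pair (identity towards the sigma-algebra of [G], [H]) agrees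
    with a product measure on rectangles, hence everywhere; Tonelli then integrates [H] out for
    fixed [w]. *)
Lemma independent_integral d' (S : measurableType d') (H : T -> S)
    (nu : probability S R) (mH : measurable_fun setT H) :
  (forall A U, <<s G >> A -> measurable U ->
    P (A `&` H @^-1` U) = (P A * nu U)%E) ->
  forall f : g_sigma_algebraType G * S -> \bar R, measurable_fun setT f ->
  (forall x, 0 <= f x)%E ->
  (\int[P]_w f (w, H w) = \int[P]_w \int[nu]_u f (w, u))%E.
Proof.
move=> indep f mf f0.
have mid := measurable_g_sigma Gm.
pose idG : {mfun T >-> g_sigma_algebraType G} := mfun_Sub (mem_set mid).
pose PG := distribution P idG.
pose W (w : T) : g_sigma_algebraType G * S := (w, H w).
have mW : measurable_fun [set: T] W by exact: (measurable_fun_pair mid mH).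
have -> : (\int[P]_w f (w, H w) =
   \int[pushforward P W]_z f z)%E.
  by rewrite ge0_integral_pushforward.
have -> : (\int[pushforward P W]_z f z)%E
    = (\int[(PG \x nu)%E]_z f z)%E.
  apply: eq_measure_integral => /= A mA _.
  exact/esym/product_measure_unique.
rewrite fubini_tonelli1// ge0_integral_pushforward//.
  exact: measurable_fun_fubini_tonelli_F.
by move=> x _; exact: integral_ge0.
Qed.

(** Restricting [P] to [D] and weighting [P] by [q] give the same measure on the events generated by
    [G], which are all that [f] sees. Thus [q] acts as the conditional probability of [D]. *)
Lemma density_integral (D : set T) (q : T -> R) : measurable D ->
  measurable_fun setT q -> (forall x, 0 <= q x) ->
  (forall E, <<s G >> E -> P (E `&` D) = \int[P]_(x in E) (q x)%:E)%E ->
  forall f : g_sigma_algebraType G -> \bar R, measurable_fun setT f ->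
  (forall x, 0 <= f x)%E ->
  (\int[P]_(w in D) f w = \int[P]_w (f w * (q w)%:E))%E.
Proof.
move=> mD mq q0 hq f mf f0.
have mid := measurable_g_sigma Gm.
have mfT : measurable_fun setT (f : T -> \bar R) by exact: (measurableT_comp mf mid).
have mDq : measurable_fun setT (\1_D : T -> R) by exact: measurable_indic.
have D0 x : 0 <= (\1_D x : R) by [].
transitivity (\int[density_measure P \1_D]_w f w)%E.
  rewrite integral_density_measure// [LHS]integral_mkcond.
  apply: eq_integral => x _; rewrite patchE indicE.
  by case: ifPn => _; rewrite ?mule1 ?mule0.
rewrite -(integral_density_measure _ mq)//.
transitivity (\int[pushforward (density_measure P \1_D) (id : T -> g_sigma_algebraType G)]_w f w)%E.
  by rewrite ge0_integral_pushforward.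
transitivity (\int[pushforward (density_measure P q) (id : T -> g_sigma_algebraType G)]_w f w)%E.
  apply: eq_measure_integral => A mA _; change (density_measure P \1_D A = density_measure P q A).
  rewrite /density_measure -hq// integral_indic//.
    by rewrite setIC.
  exact: G_measurable.
by rewrite ge0_integral_pushforward.
Qed.

End g_sigma_integrals.

(** * Segment intersection and measurability of line of sight *)

Section segment_intersection.
Context (R : realType).
Implicit Types (z c e : R * R) (h : R).

Definition cross z e : R := z.1 * e.2 - z.2 * e.1.
Definition dot z e : R := z.1 * e.1 + z.2 * e.2.

(* Cramer's rule when the segments are not parallel; otherwise [z] is
   [dot z e] times the unit vector [e] and the question is one-dimensional. *)
Definition segment_meets z c e h : bool :=
  if cross z e == 0 then
    [&& cross c e == 0,
        (- h <= dot c e) || (dot z e - dot c e <= h) &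
        (dot c e <= h) || (- h <= dot z e - dot c e)]
  else
    [&& 0 <= cross c e * cross z e, cross c e * cross z e <= cross z e ^+ 2 &
        `|cross c z| <= h * `|cross z e|].

(** In [u z = c + v e], the cross product with [e] determines [u] and that with [z] determines [v];
    the bounds on them are multiplied out by the determinant to avoid division. When [z] is parallel
    to [e], the interval with ends 0 and [dot z e] must meet the interval of radius [h] about
    [dot c e], and the disjunctions express this whatever the sign of [dot z e]. *)
Lemma segment_meetsP z c e h : dot e e = 1 -> 0 <= h ->
  reflect (exists u v, [/\ 0 <= u <= 1, `|v| <= h &
             u * z.1 = c.1 + v * e.1 /\ u * z.2 = c.2 + v * e.2])
    (segment_meets z c e h).
Proof.
rewrite /segment_meets /cross /dot; case: z c e => [z1 z2] [c1 c2] [e1 e2] /= e11 h0.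
apply: (iffP idP); last first.
  move=> [u [v [/andP[u0 u1] vh [E1 E2]]]].
  have Dc : c1 * e2 - c2 * e1 = u * (z1 * e2 - z2 * e1) by nra.
  have Dv : c1 * z2 - c2 * z1 = v * (z1 * e2 - z2 * e1) by nra.
  case: ifPn => [/eqP D0|D0].
    rewrite Dc D0 mulr0 eqxx/=.
    have E : u * (z1 * e1 + z2 * e2) = (c1 * e1 + c2 * e2) + v.
      have -> : u * (z1 * e1 + z2 * e2) = (u * z1) * e1 + (u * z2) * e2 by ring.
      by rewrite E1 E2 -[v in RHS]mulr1 -e11; ring.
    move: E; set k := z1 * e1 + z2 * e2; set f := c1 * e1 + c2 * e2 => E.
    move: vh; rewrite ler_norml => /andP[v1 v2].
    have kp : 0 <= k -> 0 <= u * k /\ 0 <= (1 - u) * k.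
      by move=> k0; rewrite !mulr_ge0// subr_ge0.
    have kn : k < 0 -> u * k <= 0 /\ (1 - u) * k <= 0.
      by move=> /ltW k0; rewrite !mulr_ge0_le0// subr_ge0.
    apply/andP; split; apply/orP.
      have [|H] := leP (- h) f; [by left|right].
      by have [/kp[]|/kn[]] := leP 0 k; lra.
    have [|H] := leP f h; [by left|right].
    by have [/kp[]|/kn[]] := leP 0 k; lra.
  rewrite Dc Dv normrM -mulrA -expr2 ler_wpM2r//.
  by rewrite mulr_ge0 ?sqr_ge0//= -[leRHS]mul1r ler_wpM2r// sqr_ge0.
set D := z1 * e2 - z2 * e1.
case: ifPn => [/eqP D0|D0].
  set k := z1 * e1 + z2 * e2; set f := c1 * e1 + c2 * e2.
  move=> /and3P[/eqP Dc H1 H2].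
  have parallel a b : a * e2 - b * e1 = 0 ->
      a = (a * e1 + b * e2) * e1 /\ b = (a * e1 + b * e2) * e2.
    move=> ab0; split; rewrite -[LHS]mulr1 -e11.
      by rewrite -[RHS]addr0 -(mul0r e2) -ab0; ring.
    by rewrite -[RHS]subr0 -(mul0r e1) -ab0; ring.
  have [Ez1 Ez2] := parallel _ _ D0.
  have [Ec1 Ec2] := parallel _ _ Dc.
  rewrite -/k in Ez1 Ez2; rewrite -/f in Ec1 Ec2.
  suff [u [v [u01 vh E]]] : exists u v, [/\ 0 <= u <= 1, `|v| <= h & u * k = f + v].
    exists u, v; split => //.
    by rewrite [in u * z1]Ez1 Ez2 [in RHS]Ec1 Ec2 !mulrA E mulrDl [(_ + v) * e2]mulrDl.
  (* If neither end of the link ([u = 0] or [u = 1]) lies on the blockage, the whole blockage lies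
     strictly inside the link, so its centre, [v = 0], is a common point. *)
  have [F1|F1] := leP `|f| h.
    by exists 0, (- f); rewrite normrN lexx ler01 F1 mul0r subrr.
  have [F2|F2] := leP `|k - f| h.
    by exists 1, (k - f); rewrite lexx ler01 F2 mul1r; split => //; ring.
  clearbody k f; clear D D0.
  move: F1 F2; rewrite !ltr_normr => F1 F2.
  have k0 : k != 0.
    apply/eqP => k0; rewrite k0 in H1 H2.
    by move: F1 H1 H2 => /orP[?|?] /orP[?|?] /orP[?|?]; lra.
  exists (f / k), 0; rewrite normr0 h0 addr0 divfK//; split => //.
  have [k_gt0|k_lt0] : 0 < k \/ k < 0 by move: k0; rewrite neq_lt => /orP[]; auto.
    clear - F1 F2 H1 H2 k_gt0.
    rewrite ler_pdivrMr// ler_pdivlMr// mul0r mul1r.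
    by apply/andP; split; move: F1 F2 H1 H2 => /orP[?|?] /orP[?|?] /orP[?|?] /orP[?|?]; lra.
  clear - F1 F2 H1 H2 k_lt0.
  rewrite ler_ndivrMr// ler_ndivlMr// mul0r mul1r.
  by apply/andP; split; move: F1 F2 H1 H2 => /orP[?|?] /orP[?|?] /orP[?|?] /orP[?|?]; lra.
move=> /and3P[H1 H2 H3].
have D2 : 0 < D ^+ 2 by rewrite exprn_even_gt0.
exists ((c1 * e2 - c2 * e1) / D), ((c1 * z2 - c2 * z1) / D); split.
- have -> : (c1 * e2 - c2 * e1) / D = (c1 * e2 - c2 * e1) * D / D ^+ 2 by field.
  by rewrite ler_pdivlMr// ler_pdivrMr// mul0r mul1r H1.
- by rewrite normrM normfV ler_pdivrMr// normr_gt0.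
- by split; move: D0; rewrite /D => D0; field.
Qed.

End segment_intersection.

Section los_measurability.
Context (R : realType) (B : segment_process R).

Definition blocks (j : nat) (x : plane R) (w : sp_space B) : bool :=
  segment_meets x (sp_center B j w)
    (cos (sp_orient B j w), sin (sp_orient B j w)) (sp_length B j w / 2).

Hypothesis length_ge0 : forall j w, 0 <= sp_length B j w.

Lemma is_losP x w : is_los B x w <-> forall j, ~~ blocks j x w.
Proof.
have unit j : dot (cos (sp_orient B j w), sin (sp_orient B j w))
     (cos (sp_orient B j w), sin (sp_orient B j w)) = 1.
  by rewrite /dot/= -!expr2 cos2Dsin2.
have hl j : 0 <= sp_length B j w / 2 by rewrite divr_ge0.
split=> [los j|nb j].
  apply/negP => /(segment_meetsP _ _ (unit j) (hl j)) [u [v [u01 vh [E1 E2]]]].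
  have : (link x `&` blockage B j w) (u * x.1, u * x.2).
    by split; [exists u|exists v => //; rewrite -E1 -E2].
  by rewrite los.
apply/seteqP; split => // z [[u u01 ->] [v vh [E1 E2]]].
by move/negP: (nb j); apply; apply/(segment_meetsP _ _ (unit j) (hl j)); exists u, v.
Qed.

Hypothesis meas_center : forall j, measurable_fun setT (sp_center B j).
Hypothesis meas_length : forall j, measurable_fun setT (sp_length B j).
Hypothesis meas_orient : forall j, measurable_fun setT (sp_orient B j).

Lemma measurable_blocks j : measurable_fun [set: plane R * sp_space B]
  (fun zw => blocks j zw.1 zw.2).
Proof.
have mz1 : measurable_fun setT (fun zw : plane R * sp_space B => zw.1.1 : R).
  exact: (measurableT_comp measurable_fst measurable_fst).
have mz2 : measurable_fun setT (fun zw : plane R * sp_space B => zw.1.2 : R).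
  exact: (measurableT_comp measurable_snd measurable_fst).
have mc1 : measurable_fun setT (fun zw : plane R * sp_space B => (sp_center B j zw.2).1 : R).
  exact: (measurableT_comp measurable_fst (measurableT_comp (meas_center j) measurable_snd)).
have mc2 : measurable_fun setT (fun zw : plane R * sp_space B => (sp_center B j zw.2).2 : R).
  exact: (measurableT_comp measurable_snd (measurableT_comp (meas_center j) measurable_snd)).
have mo : measurable_fun setT (fun zw : plane R * sp_space B => sp_orient B j zw.2 : R).
  exact: (measurableT_comp (meas_orient j) measurable_snd).
have ml : measurable_fun setT (fun zw : plane R * sp_space B => sp_length B j zw.2 / 2 : R).
  by apply: measurable_funM => //; exact: (measurableT_comp (meas_length j) measurable_snd).
have me1 : measurable_fun setT (fun zw : plane R * sp_space B => cos (sp_orient B j zw.2) : R).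
  by apply: measurableT_comp mo; apply: continuous_measurable_fun; exact: continuous_cos.
have me2 : measurable_fun setT (fun zw : plane R * sp_space B => sin (sp_orient B j zw.2) : R).
  by apply: measurableT_comp mo; apply: continuous_measurable_fun; exact: continuous_sin.
rewrite /blocks /segment_meets /cross /dot/=.
have m1 := measurable_funB (measurable_funM mz1 me2) (measurable_funM mz2 me1).
have m2 := measurable_funB (measurable_funM mc1 me2) (measurable_funM mc2 me1).
have m3 := measurable_funB (measurable_funM mc1 mz2) (measurable_funM mc2 mz1).
have m4 := measurable_funD (measurable_funM mz1 me1) (measurable_funM mz2 me2).
have m5 := measurable_funD (measurable_funM mc1 me1) (measurable_funM mc2 me2).
have mh := measurableT_comp (@oppr_measurable R setT) ml.
have m6 := measurable_funB m4 m5.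
apply: measurable_fun_ifT.
- exact: measurable_fun_eqr.
- apply: measurable_and; first exact: measurable_fun_eqr.
  by apply: measurable_and; apply: measurable_or; exact: measurable_fun_ler.
- apply: measurable_and; first by apply: measurable_fun_ler => //; exact: measurable_funM.
  apply: measurable_and; apply: measurable_fun_ler.
  + exact: measurable_funM.
  + exact: measurable_funX.
  + exact: measurableT_comp.
  + by apply: measurable_funM => //; exact: measurableT_comp.
Qed.

(** Measurability is joint in the link end and the outcome: only then are probabilities of sections
    measurable in the link end. *)
Lemma measurable_is_los : measurable [set zw : plane R * sp_space B | is_los B zw.1 zw.2].
Proof.
rewrite (_ : [set _ | _] = \bigcap_j ((fun zw => blocks j zw.1 zw.2) @^-1` [set false])).
  apply: bigcap_measurable => // j _; rewrite -[X in measurable X]setTI.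
  by apply: measurable_blocks.
apply/seteqP; split => zw /=.
  by move=> /is_losP H j _; apply/negbTE/H.
by move=> H; apply/is_losP => j; apply/negbT/H.
Qed.

Lemma measurable_has_type v :
  measurable [set zw : plane R * sp_space B | has_type B v zw.1 zw.2].
Proof.
case: v; first exact: measurable_is_los.
exact: (measurableC measurable_is_los).
Qed.

Lemma measurable_has_type_section v x : measurable [set w | has_type B v x w].
Proof.
rewrite (_ : [set _ | _] = xsection [set zw : plane R * sp_space B | has_type B v zw.1 zw.2] x).
  by apply: measurable_xsection; exact: measurable_has_type.
by rewrite xsectionE.
Qed.

(** The probability at [z] is the measure of the section at [z] of a measurable set of the product
    space. The first link stays fixed at [x], later the given station laid on the first axis. *)
Lemma measurable_prob_types s v x : measurable_fun setT
  (fun z : plane R => fine (sp_prob B [set w | has_type B s x w /\ has_type B v z w])).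
Proof.
apply: measurableT_comp => //=.
pose A := [set zw : plane R * sp_space B | has_type B v zw.1 zw.2] `&`
          (snd @^-1` [set w | has_type B s x w]).
have mA : measurable A.
  apply: measurableI; first exact: measurable_has_type.
  rewrite -[X in measurable X]setTI; apply: measurable_snd => //.
  exact: measurable_has_type_section.
have := measurable_fun_xsection (sp_prob B) mA; congr measurable_fun.
apply/funext => z /=; congr (sp_prob B _); rewrite xsectionE.
by apply/seteqP; split => w [].
Qed.

End los_measurability.

(** * Changes of variables on the real line *)

Section substitution.
Context (R : realType).
Local Notation mu := (@lebesgue_measure R).

(* It is enough to test a substitution on intervals, so continuity of the
   integrand plays no role. *)
Lemma ge0_integral_substitution (phi q : measurableTypeR R -> measurableTypeR R) :
  measurable_fun setT phi -> measurable_fun setT q -> (forall x, 0 <= q x) ->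
  (forall a b : R, (a < b)%R ->
     \int[mu]_(x in phi @^-1` [set` `]a, b]%R]) (q x)%:E = (b - a)%R%:E)%E ->
  forall f : R -> \bar R, measurable_fun setT f -> (forall x, 0 <= f x)%E ->
  (\int[mu]_x f x = \int[mu]_x (f (phi x) * (q x)%:E))%E.
Proof.
move=> mphi mq q0 hq f mf f0.
rewrite -(integral_density_measure mu mq q0 (f := f \o phi)); last 2 first.
- exact: (measurableT_comp mf mphi).
- by move=> x; exact: f0.
transitivity (\int[pushforward (density_measure mu q) phi]_y f y)%E; last first.
  by rewrite (ge0_integral_pushforward mphi).
apply: eq_measure_integral => A mA _; apply: lebesgue_measure_unique => //.
move=> _ [[a b] _ <-]; rewrite lebesgue_measure_itv/= lte_fin.
have [ab|ba] := ltP a b; first by rewrite /pushforward/= /density_measure hq.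
by rewrite /pushforward set_itv_ge ?bnd_simp -?leNgt//= preimage_set0 measure0.
Qed.

Lemma ge0_integral_scale (c : R) (f : R -> \bar R) : 0 < c ->
  measurable_fun setT f -> (forall x, 0 <= f x)%E ->
  (\int[mu]_x f x = \int[mu]_x (f (c * x)%R * c%:E))%E.
Proof.
move=> c0; move: f; apply: (@ge0_integral_substitution ( *%R c) (cst c)).
- exact: mulrl_measurable.
- exact: measurable_cst.
- by move=> ? /=; exact: ltW.
move=> a b ab /=.
rewrite (_ : _ @^-1` _ = `]a / c, b / c]%classic).
  rewrite integral_cst//= lebesgue_measure_itv/= lte_fin ltr_pM2r ?invr_gt0// ab.
  by rewrite -EFinD -EFinM -mulrBl mulrC divfK ?gt_eqF.
apply/seteqP; split => x /=; rewrite !in_itv/= ltr_pdivrMr// ler_pdivlMr//;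
  by rewrite [x * c]mulrC.
Qed.

Lemma ge0_integral_translate (c : R) (f : R -> \bar R) :
  measurable_fun setT f -> (forall x, 0 <= f x)%E ->
  (\int[mu]_x f x = \int[mu]_x f (x + c)%R)%E.
Proof.
move=> mf f0.
rewrite (@ge0_integral_substitution (fun x => x + c) (cst 1)) => //.
- by apply: eq_integral => x _; rewrite mule1.
- by apply: measurable_funD => //; exact: measurable_id.
move=> a b ab /=.
rewrite (_ : _ @^-1` _ = `]a - c, b - c]%classic).
  rewrite integral_cst//= mul1e lebesgue_measure_itv/= lte_fin ltrD2r ab.
  by rewrite -EFinD; congr EFin; ring.
by apply/seteqP; split => x /=; rewrite !in_itv/= ltrBlDr lerBrDr.
Qed.

Lemma ge0_integral_reflect (f : R -> \bar R) :
  measurable_fun setT f -> (forall x, 0 <= f x)%E ->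
  (\int[mu]_x f x = \int[mu]_x f (- x)%R)%E.
Proof.
move=> mf f0.
rewrite (@ge0_integral_substitution -%R (cst 1)) => //.
- by apply: eq_integral => x _; rewrite mule1.
move=> a b ab /=.
rewrite (_ : _ @^-1` _ = `[- b, - a[%classic).
  rewrite integral_cst//= mul1e lebesgue_measure_itv/= lte_fin ltrN2 ab.
  by rewrite -EFinD; congr EFin; ring.
by apply/seteqP; split => x /=; rewrite !in_itv/= ltrNr lerNl andbC.
Qed.

Lemma cos_neq0_half_pi (x : R) : x \in `]- (pi / 2), pi / 2[ -> cos x != 0.
Proof. by move=> xI; rewrite gt_eqF// cos_gt0_pihalf//; rewrite in_itv in xI. Qed.

Let I : set R := `]- (pi / 2), pi / 2[%classic.

(** The density is the derivative of the tangent, so on intervals the identity is the fundamental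
    theorem of calculus between [atan a] and [atan b]. *)
Lemma ge0_integral_tan (f : R -> \bar R) :
  measurable_fun setT f -> (forall x, 0 <= f x)%E ->
  (\int[mu]_x f x = \int[mu]_(x in I) (f (tan x) * (cos x ^- 2)%:E))%E.
Proof.
move=> mf f0.
have mI : measurable I by exact: measurable_itv.
have oI : open I by exact: interval_open.
have dcos (x : R) : x \in `]- (pi / 2), pi / 2[ -> {for x, continuous (fun x : R => cos x ^- 2 : R)}.
  move=> xI; apply: cvgV; first by rewrite expf_neq0// cos_neq0_half_pi.
  by rewrite expr2; apply: cvgM; exact: continuous_cos.
have mcos : measurable_fun I (fun x : R => cos x ^- 2 : R).
  by apply: open_continuous_measurable_fun => // x /set_mem /dcos.
rewrite (@ge0_integral_substitution (tan \_ I) ((fun x => cos x ^- 2) \_ I)) => //.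
(* Outside the open interval both the map and its density are extended by 0. Such points may enter a
   preimage of an interval containing 0, but they carry no mass. *)
- rewrite [RHS]integral_mkcond; apply: eq_integral => x _.
  by rewrite !patchE; case: ifPn; rewrite ?mule0.
- apply/(measurable_restrictT _ mI) => //; apply: open_continuous_measurable_fun => //.
  by move=> x /set_mem xI; exact/continuous_tan/cos_neq0_half_pi.
- exact/(measurable_restrictT _ mI).
- by move=> x; rewrite patchE; case: ifP => // _; rewrite invr_ge0 sqr_ge0.
move=> a b ab.
have atanab : atan a < atan b by exact: lt_atan.
have abI x : x \in `[atan a, atan b] -> x \in `]- (pi / 2), pi / 2[.
  rewrite !in_itv/= => /andP[ax xb].
  by rewrite (lt_le_trans (atan_gtNpi2 a))//= (le_lt_trans xb (atan_ltpi2 b)).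
transitivity (\int[mu]_(x in `[atan a, atan b]) (cos x ^- 2)%:E)%E; last first.
  rewrite (@continuous_FTC2 _ _ tan)//.
  - by rewrite !atanK.
  - by apply: continuous_in_subspaceT => x /set_mem /abI /dcos.
  - split.
    + move=> x xab; apply: ex_derive; apply: is_derive_tan.
      by apply: cos_neq0_half_pi; apply: abI; exact: subset_itv_oo_cc.
    + apply: cvg_at_right_filter; apply: continuous_tan; apply: cos_neq0_half_pi.
      by apply: abI; rewrite in_itv/= lexx ltW.
    + apply: cvg_at_left_filter; apply: continuous_tan; apply: cos_neq0_half_pi.
      by apply: abI; rewrite in_itv/= lexx ltW.
  - move=> x xab; rewrite derive1E; apply: derive_val; apply: is_derive_tan.
    by apply: cos_neq0_half_pi; apply: abI; exact: subset_itv_oo_cc.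
rewrite -integral_itv_obnd_cbnd; last first.
  apply/measurable_EFinP; apply: measurable_funS mcos => // x xab.
  by apply: abI; exact: subset_itv_oc_cc.
rewrite integral_mkcond [RHS]integral_mkcond; apply: eq_integral => x _.
rewrite !patchE; have [xI|xI] := boolP (x \in I); last first.
  transitivity (0%E : \bar R); first by case: ifP.
  rewrite ifF//; apply: contraNF xI => /set_mem xab.
  by apply/mem_set/abI; exact: subset_itv_oc_cc xab.
have atan_le : {mono @atan R : u v / u <= v} := le_mono (@lt_atan R).
have xtan : x = atan (tan x) by rewrite tanK//; exact: set_mem xI.
have xE : (a < tan x <= b) = (atan a < x <= atan b).
  by rewrite [in RHS]xtan (leW_mono atan_le) atan_le.
congr (if _ then _ else _); apply/idP/idP => /set_mem H; apply/mem_set; move: H.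
  by rewrite /= patchE xI !in_itv/= xE.
by rewrite /= [in X in _ -> X]patchE xI !in_itv/= -xE.
Qed.

End substitution.

(** * Polar coordinates and rotations *)

Section polar_integral.
Context (R : realType).
Local Notation mu := (@lebesgue_measure R).
Let I : set R := `]- (pi / 2), pi / 2[%classic.

Lemma measurable_plane (d : measure_display) (T : measurableType d)
    (f g : T -> R) : measurable_fun setT f -> measurable_fun setT g ->
  measurable_fun setT (fun x => (f x, g x) : plane R).
Proof. by move=> mf mg; exact: (measurable_fun_pair mf mg). Qed.

Lemma measurable_cos : measurable_fun setT (@cos R).
Proof. by apply: continuous_measurable_fun; exact: continuous_cos. Qed.

Lemma measurable_sin : measurable_fun setT (@sin R).
Proof. by apply: continuous_measurable_fun; exact: continuous_sin. Qed.

Lemma measurable_polar :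
  measurable_fun setT (fun x : measurableTypeR R * measurableTypeR R => polar x.1 x.2).
Proof.
apply: measurable_plane; apply: measurable_funM => //.
  exact: (measurableT_comp measurable_cos measurable_snd).
exact: (measurableT_comp measurable_sin measurable_snd).
Qed.

(* [y = x tan theta] on each vertical line, then [x = t cos theta] for each
   fixed [theta]. *)
Lemma integral_right_half_plane (F : plane R -> \bar R) :
  measurable_fun setT F -> (forall z, 0 <= F z)%E ->
  (\int[mu]_(x in `]0%R, +oo[) \int[mu]_y F (x, y) =
   \int[mu]_(theta in I) \int[mu]_(t in `]0%R, +oo[) (F (polar t theta) * t%:E))%E.
Proof.
move=> mF F0.
have mI : measurable I by exact: measurable_itv.
have mpos : measurable (`]0, +oo[%classic : set R) by exact: measurable_itv.
pose q : R -> R := (fun theta : R => cos theta ^- 2) \_ I.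
pose tanI : R -> R := tan \_ I.
pose xp : R -> R := (fun x : R => x) \_ (`]0, +oo[%classic : set R).
have q0 th : 0 <= q th.
  by rewrite /q patchE; case: ifP => // _; rewrite invr_ge0 sqr_ge0.
have xp0 x : 0 <= xp x.
  rewrite /xp patchE; case: ifP => // /set_mem/=; rewrite in_itv/= andbT.
  exact: ltW.
have mq : measurable_fun setT q.
  apply/(measurable_restrictT _ mI).
  apply: open_continuous_measurable_fun; first exact: interval_open.
  move=> x /set_mem xI; apply: cvgV; first by rewrite expf_neq0// cos_neq0_half_pi.
  by rewrite expr2; apply: cvgM; exact: continuous_cos.
have mtan : measurable_fun setT tanI.
  apply/(measurable_restrictT _ mI).
  apply: open_continuous_measurable_fun; first exact: interval_open.
  by move=> x /set_mem xI; exact/continuous_tan/cos_neq0_half_pi.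
have mxp : measurable_fun setT xp by exact/(measurable_restrictT _ mpos).
(* Both domains, positive [x] and [theta] in the open interval, are encoded by zero extensions, so
   that Tonelli applies on the whole plane. The weight is the Jacobian [x / cos^2] of
   [y = x tan theta]. *)
pose G (z : plane R) : \bar R := (F (z.1, z.1 * tanI z.2)%R * (xp z.1 * q z.2)%:E)%E.
have mG : measurable_fun setT G.
  apply: emeasurable_funM.
    apply: (measurableT_comp mF); apply: measurable_plane => //.
    by apply: measurable_funM => //; exact: (measurableT_comp mtan measurable_snd).
  apply/measurable_EFinP; apply: measurable_funM.
    exact: (measurableT_comp mxp measurable_fst).
  exact: (measurableT_comp mq measurable_snd).
have G0 z : (0 <= G z)%E by rewrite mule_ge0// lee_fin mulr_ge0.
transitivity (\int[mu]_x \int[mu]_theta G (x, theta))%E.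
  rewrite [LHS]integral_mkcond; apply: eq_integral => x _.
  rewrite patchE; case: ifPn => [xpos|xneg]; last first.
    by rewrite integral0_eq// => th _; rewrite /G/= /xp patchE (negbTE xneg) mul0r mule0.
  have x0 : 0 < x by move: xpos => /set_mem/=; rewrite in_itv/= andbT.
  have mFx : measurable_fun setT (fun y : R => F (x, y)).
    apply: (measurableT_comp mF); exact: measurable_plane.
  rewrite (ge0_integral_scale x0)//.
  rewrite ge0_integral_tan//; last 2 first.
  - apply: emeasurable_funM => //; apply: (measurableT_comp mF).
    by apply: measurable_plane => //; exact: mulrl_measurable.
  - by move=> y; rewrite mule_ge0// lee_fin ltW.
  rewrite integral_mkcond; apply: eq_integral => th _.
  rewrite patchE /G/= /tanI /q /xp !patchE xpos.
  by case: ifPn => thI; rewrite ?mulr0 ?mule0// EFinM muleA.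
rewrite (@fubini_tonelli _ _ _ _ _ mu mu G mG G0).
rewrite [RHS]integral_mkcond; apply: eq_integral => th _.
rewrite /fubini_G patchE; case: ifPn => thI; last first.
  by rewrite integral0_eq// => x _; rewrite /G/= /q patchE (negbTE thI) mulr0 mule0.
have c0 : 0 < cos th.
  by apply: cos_gt0_pihalf; move: thI => /set_mem; rewrite /I/= in_itv.
rewrite (ge0_integral_scale c0)//; last first.
  by apply: (measurableT_comp mG); exact: measurable_plane.
rewrite [RHS]integral_mkcond; apply: eq_integral => t _.
(* With [x = t cos theta], the weight [x / cos^2] times the factor [cos theta] of the scaling leaves
   exactly [t]. *)
rewrite /G/= /tanI /q /xp !patchE thI -muleA -EFinM.
have -> : (cos th * t \in `]0, +oo[%classic) = (t \in `]0, +oo[%classic).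
  by apply/idP/idP => /set_mem H; apply/mem_set; move: H; rewrite /= !in_itv/= !andbT pmulr_rgt0.
case: ifPn => t0; last by rewrite !mul0r mule0.
rewrite /polar; congr (F _ * _%:E)%E.
  by congr pair; rewrite ?[cos th * t]mulrC// -mulrA; congr (t * _); rewrite mulrC /tan divfK ?gt_eqF.
by field; rewrite gt_eqF.
Qed.

Section periodic.
Context (T : R) (g : R -> \bar R).
Hypotheses (mg : measurable_fun setT g) (g0 : (forall x, 0 <= g x)%E).
Hypothesis gT : forall x, g (x + T) = g x.

Lemma integral_itv_translate (a b c : R) :
  (\int[mu]_(x in `]a, b]) g (x + c)%R = \int[mu]_(x in `](a + c)%R, (b + c)%R]) g x)%E.
Proof.
rewrite [RHS]integral_mkcond (ge0_integral_translate c); last 2 first.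
- by apply/(measurable_restrictT g) => //; exact: measurable_funTS.
- by move=> x; exact: erestrict_ge0.
rewrite [LHS]integral_mkcond; apply: eq_integral => x _; rewrite !patchE.
congr (if _ then _ else _); apply/idP/idP => /set_mem H; apply/mem_set; move: H;
  by rewrite /= !in_itv/= ltrD2r lerD2r.
Qed.

Lemma integral_itv_cat (u v w : R) : u <= v -> v <= w ->
  (\int[mu]_(x in `]u, w]) g x =
   \int[mu]_(x in `]u, v]) g x + \int[mu]_(x in `]v, w]) g x)%E.
Proof.
move=> uv vw; rewrite -ge0_integral_setU//=.
- by rewrite -itv_bndbnd_setU ?bnd_simp.
- exact: measurable_funTS.
- apply/disj_setPS => x []/=; rewrite !in_itv/= => /andP[_ xv] /andP[vx _].
  by move: (lt_le_trans vx xv); rewrite ltxx.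
Qed.

(** The shifted window loses its initial piece of length [a] and gains a translate of it by one
    period. *)
Lemma integral_periodic_shift (a : R) : 0 <= a <= T ->
  (\int[mu]_(x in `]0%R, T]) g (x + a)%R = \int[mu]_(x in `]0%R, T]) g x)%E.
Proof.
move=> /andP[a0 aT]; rewrite integral_itv_translate add0r.
rewrite (@integral_itv_cat a T (T + a)) ?lerDl// (@integral_itv_cat 0 a T)// addeC; congr (_ + _)%E.
have := integral_itv_translate 0 a T; rewrite add0r [a + T]addrC => <-.
by apply: eq_integral => x _; rewrite gT.
Qed.

End periodic.

Lemma measurable_polar_integral (F : plane R -> \bar R) :
  measurable_fun setT F -> (forall z, 0 <= F z)%E ->
  measurable_fun setT (fun theta =>
    \int[mu]_(t in `]0%R, +oo[) (F (polar t theta) * t%:E))%E.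
Proof.
move=> mF F0.
pose xp : R -> R := (fun x : R => x) \_ (`]0, +oo[%classic : set R).
have mpos : measurable (`]0, +oo[%classic : set R) by exact: measurable_itv.
have mxp : measurable_fun setT xp by exact/(measurable_restrictT _ mpos).
have xp0 x : 0 <= xp x.
  rewrite /xp patchE; case: ifP => // /set_mem/=; rewrite in_itv/= andbT.
  exact: ltW.
pose G (z : plane R) : \bar R := (F (polar z.2 z.1) * (xp z.2)%:E)%E.
have mG : measurable_fun setT G.
  apply: emeasurable_funM.
    apply: (measurableT_comp mF).
    have mswap := measurable_plane measurable_snd measurable_fst.
    exact: (measurableT_comp measurable_polar mswap).
  apply/measurable_EFinP; exact: (measurableT_comp mxp measurable_snd).
have G0 z : (0 <= G z)%E by rewrite mule_ge0// lee_fin.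
have := @measurable_fun_fubini_tonelli_F _ _ _ _ _ mu G mG G0; congr measurable_fun.
apply/funext => th; rewrite [RHS]integral_mkcond; apply: eq_integral => t _.
by rewrite /G/= /xp !patchE; case: ifP; rewrite ?mule0.
Qed.

Lemma polarN (t theta : R) : polar t (theta + pi) = (- (polar t theta).1, - (polar t theta).2).
Proof. by rewrite /polar cosDpi sinDpi !mulrN. Qed.

Lemma polar2pi (t theta : R) : polar t (theta + 2 * pi) = polar t theta.
Proof. by rewrite /polar mulr_natl cosD2pi sinD2pi. Qed.

(** The left half plane is the right one under point reflection, which adds pi to the angle. The two
    half-turns join into a window of length [2 * pi] starting at [- (pi / 2)]. *)
Lemma integral_polar (F : plane R -> \bar R) :
  measurable_fun setT F -> (forall z, 0 <= F z)%E ->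
  (\int[@area R]_z F z =
   \int[mu]_(theta in `[0%R, (2 * pi)%R]) \int[mu]_(t in `]0%R, +oo[)
     (F (polar t theta) * t%:E))%E.
Proof.
move=> mF F0.
pose g theta := (\int[mu]_(t in `]0%R, +oo[) (F (polar t theta) * t%:E))%E.
have mg : measurable_fun setT g by exact: measurable_polar_integral.
have g0 theta : (0 <= g theta)%E.
  apply: integral_ge0 => t /=; rewrite in_itv/= andbT => t0.
  by rewrite mule_ge0// lee_fin ltW.
have gT theta : g (theta + 2 * pi) = g theta.
  by apply: eq_integral => t _; rewrite polar2pi.
pose phi x := (\int[mu]_y F (x, y))%E.
have mphi : measurable_fun setT phi by exact: (@measurable_fun_fubini_tonelli_F _ _ _ _ _ mu F mF F0).
have phi0 x : (0 <= phi x)%E by exact: integral_ge0.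
pose F' (z : plane R) := F (- z.1, - z.2).
have mF' : measurable_fun setT F'.
  apply: (measurableT_comp mF); apply: measurable_plane.
    exact: (measurableT_comp (@oppr_measurable R setT) measurable_fst).
  exact: (measurableT_comp (@oppr_measurable R setT) measurable_snd).
rewrite /area (@fubini_tonelli1 _ _ _ _ _ mu mu F mF F0) -/phi.
transitivity (\int[mu]_(x in `]0%R, +oo[) phi x + \int[mu]_(x in `]0%R, +oo[) phi (- x)%R)%E.
  have -> : (\int[mu]_(x in `]0%R, +oo[) phi (- x)%R = \int[mu]_(x in `]-oo, 0%R[) phi x)%E.
    rewrite [RHS]integral_mkcond ge0_integral_reflect; last 2 first.
    - by apply/(measurable_restrictT phi) => //; exact: measurable_funTS.
    - by move=> x; exact: erestrict_ge0.
    rewrite [LHS]integral_mkcond; apply: eq_integral => x _; rewrite !patchE.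
    congr (if _ then _ else _); apply/idP/idP => /set_mem H; apply/mem_set; move: H;
    by rewrite /= !in_itv/= ?andbT oppr_lt0.
  rewrite (@integral_itv_bndo_bndc _ -oo%O 0); last exact: measurable_funTS.
  rewrite addeC -ge0_integral_setU//=.
  - by rewrite -itv_bndbnd_setU ?bnd_simp// set_itvNyy.
  - exact: measurable_funTS.
  - apply/disj_setPS => x []/=; rewrite !in_itv/= andbT => x0 /(le_lt_trans x0).
    by rewrite ltxx.
have -> : (\int[mu]_(x in `]0%R, +oo[) phi x = \int[mu]_(theta in I) g theta)%E.
  by rewrite (integral_right_half_plane mF F0).
have -> : (\int[mu]_(x in `]0%R, +oo[) phi (- x)%R =
    \int[mu]_(theta in I) g (theta + pi)%R)%E.
  transitivity (\int[mu]_(x in `]0%R, +oo[) \int[mu]_y F' (x, y))%E.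
    apply: eq_integral => x _; rewrite /phi ge0_integral_reflect//.
    by apply: (measurableT_comp mF); exact: measurable_plane.
  rewrite (integral_right_half_plane mF' (fun z => F0 _)); apply: eq_integral => theta _.
  by apply: eq_integral => t _; rewrite polarN.
have pi0 := pi_ge0 R.
rewrite /I !integral_itv_bndo_bndc; last 2 first.
- apply: measurable_funTS; apply: (measurableT_comp mg).
  by apply: measurable_funD => //; exact: measurable_id.
- exact: measurable_funTS.
rewrite (integral_itv_translate mg g0).
have -> : - (pi / 2) + pi = pi / 2 :> R by lra.
rewrite -(integral_itv_cat mg g0); [|lra|lra].
(* Periodicity moves this window to the one starting at 0; [h] is [g] delayed by a quarter turn, so
   that the shift [pi / 2] is nonnegative. *)
pose h theta := g (theta - pi / 2).
have mh : measurable_fun setT h.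
  by apply: (measurableT_comp mg); apply: measurable_funB => //; exact: measurable_id.
have hT theta : h (theta + 2 * pi) = h theta by rewrite /h addrAC gT.
have h0 theta : (0 <= h theta)%E by exact: g0.
have pi2 : 0 <= (pi / 2 : R) <= 2 * pi.
  by rewrite divr_ge0//=; lra.
transitivity (\int[mu]_(x in `]0%R, (2 * pi)%R]) g x)%E.
  have <- : (0 - pi / 2 : R) = - (pi / 2) by rewrite sub0r.
  have -> : (pi / 2 + pi : R) = 2 * pi - pi / 2 by lra.
  rewrite -(integral_itv_translate mg g0) -[LHS](integral_periodic_shift mh h0 hT pi2).
  by apply: eq_integral => theta _; rewrite /h addrK.
by apply: integral_itv_obnd_cbnd; exact: measurable_funTS.
Qed.

End polar_integral.

Section rotation.
Context (R : realType).
Local Notation mu := (@lebesgue_measure R).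

Definition rotate (phi : R) (z : plane R) : plane R :=
  (z.1 * cos phi - z.2 * sin phi, z.1 * sin phi + z.2 * cos phi).

Lemma rotate_polar (phi t theta : R) :
  rotate phi (polar t theta) = polar t (theta + phi).
Proof. by rewrite /rotate /polar/= cosD sinD; congr pair; ring. Qed.

Lemma measurable_rotate (phi : R) : measurable_fun setT (rotate phi).
Proof.
apply: measurable_plane.
  by apply: measurable_funB; apply: measurable_funM => //.
by apply: measurable_funD; apply: measurable_funM => //.
Qed.

Lemma measurable_enorm : measurable_fun setT (@enorm R).
Proof.
apply: (measurableT_comp (f := @Num.sqrt R)).
  by apply: continuous_measurable_fun; exact: sqrt_continuous.
by apply: measurable_funD; exact: measurable_funX.
Qed.

Lemma enorm_rotate (phi : R) (z : plane R) : enorm (rotate phi z) = enorm z.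
Proof.
rewrite /enorm /rotate/=; congr Num.sqrt.
have := cos2Dsin2 phi => c2s2.
transitivity ((z.1 ^+ 2 + z.2 ^+ 2) * (cos phi ^+ 2 + sin phi ^+ 2)); first by ring.
by rewrite c2s2 mulr1.
Qed.

Lemma enorm_polar (t theta : R) : 0 <= t -> enorm (polar t theta) = t.
Proof.
move=> t0; rewrite /enorm /polar/= !exprMn -mulrDr cos2Dsin2 mulr1.
by rewrite sqrtr_sqr ger0_norm.
Qed.

Lemma enorm_ge0 (z : plane R) : 0 <= enorm z.
Proof. exact: sqrtr_ge0. Qed.

Lemma enorm_sqr (z : plane R) : enorm z ^+ 2 = z.1 ^+ 2 + z.2 ^+ 2.
Proof. by rewrite sqr_sqrtr// addr_ge0 ?sqr_ge0. Qed.

Lemma enorm_bounds (z : plane R) : -1 <= z.1 / enorm z <= 1.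
Proof.
have [->|z0] := eqVneq (enorm z) 0; first by rewrite invr0 mulr0 lerN10 ler01.
have zp : 0 < enorm z by rewrite lt_def z0 enorm_ge0.
rewrite -ler_norml normrM normfV (gtr0_norm zp) ler_pdivrMr// mul1r.
by rewrite -sqrtr_sqr ler_wsqrtr// lerDl sqr_ge0.
Qed.

Lemma polar_angle_ge0_le (z : plane R) : 0 <= polar_angle z <= 2 * pi.
Proof.
have [/andP[a0 api] _] := acos_def (enorm_bounds z).
by rewrite /polar_angle; case: ifP => _; apply/andP; split; lra.
Qed.

Lemma polar_enorm_angle (z : plane R) : polar (enorm z) (polar_angle z) = z.
Proof.
(* At the origin the value of [polar_angle] is arbitrary, but the radius vanishes. *)
have [z0|z0] := eqVneq (enorm z) 0.
  have : z.1 ^+ 2 + z.2 ^+ 2 == 0 by rewrite -enorm_sqr z0 expr0n.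
  rewrite paddr_eq0 ?sqr_ge0// !sqrf_eq0 => /andP[/eqP z10 /eqP z20].
  by rewrite /polar z0 !mul0r [RHS]surjective_pairing z10 z20.
have zp : 0 < enorm z by rewrite lt_def z0 enorm_ge0.
have [_ cosE] := acos_def (enorm_bounds z).
have sinE : enorm z * sin (acos (z.1 / enorm z)) = `|z.2|.
  rewrite sin_acos ?enorm_bounds// -{1}(gtr0_norm zp) -sqrtr_sqr -sqrtrM ?sqr_ge0//.
  by rewrite -sqrtr_sqr mulrBr mulr1 expr_div_n mulrC divfK ?expf_neq0// enorm_sqr addrC addKr.
rewrite /polar /polar_angle [RHS]surjective_pairing; case: ifPn => z2.
  by rewrite cosE mulrC divfK// sinE ger0_norm.
rewrite addrC mulr_natl cosD2pi sinD2pi cosN sinN cosE mulrC divfK// mulrN sinE.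
by rewrite ltr0_norm ?opprK// ltNge.
Qed.

(** Measuring angles from [g] amounts to rotating [g] onto the first axis, where [p_joint] lays the
    first link. This turns the angle-based type probabilities into a measurable function of the
    rotated position. *)
Lemma polar_enorm_angle_rotate (g z : plane R) :
  polar (enorm z) (angle g z) = rotate (- polar_angle g) z.
Proof.
rewrite -[z in RHS]polar_enorm_angle rotate_polar /angle/=.
by case: ifP => _//; rewrite polar2pi.
Qed.

(** In polar coordinates the rotation is a translation of the angle, absorbed by periodicity over a
    full turn. *)
Lemma integral_polar_rotate (K : plane R -> \bar R) (phi : R) : 0 <= phi <= 2 * pi ->
  measurable_fun setT K -> (forall z, 0 <= K z)%E ->
  (\int[@area R]_z K (rotate (- phi) z) =
   \int[mu]_(theta in `[0%R, (2 * pi)%R]) \int[mu]_(t in `]0%R, +oo[)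
     (K (polar t theta) * t%:E))%E.
Proof.
move=> phi2pi mK K0.
pose g theta := (\int[mu]_(t in `]0%R, +oo[) (K (polar t theta) * t%:E))%E.
have mg : measurable_fun setT g by exact: measurable_polar_integral.
have g0 theta : (0 <= g theta)%E.
  apply: integral_ge0 => t /=; rewrite in_itv/= andbT => t0.
  by rewrite mule_ge0// lee_fin ltW.
have gT theta : g (theta + 2 * pi) = g theta.
  by apply: eq_integral => t _; rewrite polar2pi.
rewrite integral_polar; last 2 first.
- exact: (measurableT_comp mK (measurable_rotate _)).
- by move=> z; exact: K0.
pose h theta := g (theta - phi).
have mh : measurable_fun setT h.
  by apply: (measurableT_comp mg); apply: measurable_funB => //; exact: measurable_id.
have hT theta : h (theta + 2 * pi) = h theta by rewrite /h addrAC gT.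
have h0 theta : (0 <= h theta)%E by exact: g0.
transitivity (\int[mu]_(theta in `[0%R, (2 * pi)%R]) h theta)%E.
  by apply: eq_integral => theta _; apply: eq_integral => t _; rewrite rotate_polar.
rewrite -integral_itv_obnd_cbnd; last exact: measurable_funTS.
rewrite -[RHS]integral_itv_obnd_cbnd; last exact: measurable_funTS.
rewrite -(integral_periodic_shift mh h0 hT phi2pi).
by apply: eq_integral => theta _; rewrite /h addrK.
Qed.

End rotation.

(** * Generating functional of a Poisson process *)

Section counting_points.
Context (R : realType) (T : Type) (X : nat -> T -> plane R).
Implicit Types (A : set (plane R)) (w : T).

Definition count_points (n : nat) A w : nat := (\sum_(i < n) (X i w \in A))%N.

Lemma count_points_sum n A w :
  ((count_points n A w)%:R%:E = \sum_(0 <= i < n) (\1_A (X i w))%:E :> \bar R)%E.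
Proof.
rewrite big_mkord sumEFin natr_sum; congr (_%:E); exact: eq_bigr.
Qed.

Lemma count_points_le n A w (k : nat) :
  npoints X A w = k%:R%:E -> (count_points n A w <= k)%N.
Proof.
move=> Xk; rewrite -(ler_nat R) -lee_fin count_points_sum -Xk.
by apply: nneseries_lim_ge => i _ _; rewrite lee_fin.
Qed.

(** The partial counts are integers bounded by their limit [k]; once within distance 1 of it they
    equal it. *)
Lemma count_points_eventually A w (k : nat) :
  npoints X A w = k%:R%:E -> \forall n \near \oo, count_points n A w = k.
Proof.
move=> Xk.
have cvgX : (count_points n A w)%:R%:E @[n --> \oo] --> (k%:R%:E : \bar R).
  rewrite -Xk /npoints; under eq_fun do rewrite count_points_sum.
  by apply: is_cvg_nneseries => i _ _; rewrite lee_fin.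
move/fine_cvgP : cvgX => [_ /cvgrPdist_lt /(_ 1 ltr01)].
apply: filterS => n /=; have := count_points_le n Xk.
rewrite leq_eqVlt => /orP[/eqP//|nk].
rewrite ger0_norm ?subr_ge0 ?ler_nat 1?ltnW// ltrBlDr addrC natr1 ltr_nat ltnS.
by rewrite leqNgt nk.
Qed.

End counting_points.

Lemma measurable_npoints d (T : measurableType d) (R : realType)
    (X : nat -> T -> plane R) (A : set (plane R)) :
  (forall i, measurable_fun setT (X i)) -> measurable A ->
  measurable_fun setT (npoints X A).
Proof.
move=> mX mA; apply: (@ge0_emeasurable_sum _ _ _ setT (fun i w => (\1_A (X i w))%:E) xpredT).
- by move=> i w _ _; rewrite lee_fin.
- move=> i _; apply/measurable_EFinP.
  exact: (measurableT_comp (measurable_indic mA) (mX i)).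
Qed.

Lemma cvg_prod_ord (R : realType) (m : nat) (f : nat -> nat -> R) (l : nat -> R) :
  (forall j, (j < m)%N -> f j n @[n --> \oo] --> l j) ->
  \prod_(j < m) f j n @[n --> \oo] --> \prod_(j < m) l j.
Proof.
elim: m => [|m IH] fl.
  by under eq_fun do rewrite big_ord0; rewrite big_ord0; exact: cvg_cst.
under eq_fun do rewrite big_ord_recr/=.
rewrite big_ord_recr/=; apply: cvgM; last exact: fl.
by apply: IH => j jm; apply: fl; exact: ltnW.
Qed.

(** The bridge between counts, of which the Poisson law speaks, and products over enumerated
    points. *)
Lemma pow_count_points (R : realType) T (X : nat -> T -> plane R) n
    (A : set (plane R)) (b : R) w :
  b ^+ count_points X n A w = \prod_(i < n) (1 - (1 - b) * \1_A (X i w)).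
Proof.
rewrite /count_points; elim: n => [|n IH]; first by rewrite !big_ord0 expr0.
rewrite !big_ord_recr/= exprD IH indicE; congr (_ * _).
by case: (_ \in _); rewrite /= ?expr1 ?expr0 ?mulr1 ?mulr0; ring.
Qed.

Section simple_functional.
Context d (T : measurableType d) (R : realType) (P : probability T R).
Context (lambda : R) (X : nat -> T -> plane R).
Hypothesis mX : forall i, measurable_fun setT (X i).
Hypothesis XP : is_PPP (fun E => fine (P E)) lambda X.
Context (m : nat) (A : nat -> set (plane R)) (a : nat -> R).
Hypothesis mA : forall j, (j < m)%N -> measurable (A j) /\ (area (A j) < +oo)%E.
Hypothesis tA : trivIset `I_m A.
Hypothesis a01 : forall j, (j < m)%N -> 0 <= a j <= 1.

Let mean j := lambda * fine (area (A j)).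
Let poisson j k := expR (- mean j) * mean j ^+ k / k`!%:R.

Let u (n : nat) (w : T) : R := \prod_(j < m) a j ^+ count_points X n (A j) w.

Let event (k : nat -> nat) : set T :=
  [set w | forall j, (j < m)%N -> npoints X (A j) w = (k j)%:R%:E].

Let measurable_event k : measurable (event k).
Proof.
rewrite (_ : event k = \bigcap_(j in `I_m) (npoints X (A j) @^-1` [set (k j)%:R%:E])).
  apply: fin_bigcap_measurable => // j jm; rewrite -[X in measurable X]setTI.
  by apply: measurable_npoints => //; exact: (mA jm).1.
by apply/seteqP; split.
Qed.

Let prob_event k : P (event k) = (\prod_(j < m) poisson j (k j))%:E.
Proof.
have [XP1 XP2] := XP.
rewrite -[LHS]fineK ?fin_num_measure//; congr EFin; rewrite XP2//.
by apply: eq_bigr => j _; have [mAj Aj] := mA (ltn_ord j); rewrite XP1.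
Qed.

Let S K (b : nat -> R) := \prod_(j < m) \sum_(k < K) b j ^+ k * poisson j k.

Let S_cvg b : S K b @[K --> \oo] --> \prod_(j < m) expR (- (mean j * (1 - b j))).
Proof.
apply: (@cvg_prod_ord _ _ (fun n K => \sum_(k < K) b n ^+ k * poisson n k)
  (fun n => expR (- (mean n * (1 - b n))))) => n nm.
rewrite (_ : expR _ = expR (- mean n) * expR (b n * mean n)); last first.
  by rewrite -expRD; congr expR; ring.
under eq_fun => K.
  rewrite (_ : \sum_(_ < _) _ = expR (- mean n) * series (exp_coeff (b n * mean n)) K).
    over.
  rewrite /series/= big_mkord mulr_sumr; apply: eq_bigr => k _.
  by rewrite /poisson /exp_coeff/= [(b n * _) ^+ _]exprMn; ring.
by apply: cvgMr; exact: is_cvg_series_exp_coeff.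
Qed.

(** Extension by 0, since the joint law in [is_PPP] takes counts indexed by all of [nat]. *)
Let ext K (k : {ffun 'I_m -> 'I_K}) (j : nat) : nat :=
  if insub j is Some i then k i else 0%N.

Let extE K (k : {ffun 'I_m -> 'I_K}) (j : 'I_m) : ext k j = k j.
Proof. by rewrite /ext valK. Qed.

(** This is the product of the [b j] raised to the full counts when every count is below [K], and 0
    otherwise. It is a finite combination of events whose probabilities are given, so its integral
    is the explicit product [S K b] of partial Poisson series. *)
Let truncated K (b : nat -> R) w : R :=
  \sum_(k : {ffun 'I_m -> 'I_K}) (\prod_(j < m) b j ^+ (k j)) * \1_(event (ext k)) w.

Let measurable_truncated K b : measurable_fun setT (truncated K b).
Proof.
by apply: measurable_sum => k; apply: measurable_funM.
Qed.

Let integral_truncated K b : (forall j, (j < m)%N -> 0 <= b j) ->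
  (\int[P]_w (truncated K b w)%:E = (S K b)%:E)%E.
Proof.
move=> b0; under eq_integral do rewrite /truncated -sumEFin.
rewrite ge0_integral_sum//; last 2 first.
- by move=> k; apply/measurable_EFinP; exact: measurable_funM.
- by move=> k w _; rewrite lee_fin mulr_ge0// prodr_ge0// => j _; rewrite exprn_ge0 ?b0.
rewrite /S bigA_distr_bigA -sumEFin; apply: eq_bigr => k _.
under eq_integral do rewrite EFinM.
rewrite ge0_integralZl_EFin//; last 2 first.
- by apply/measurable_EFinP; exact: measurable_indic.
- by rewrite prodr_ge0// => j _; rewrite exprn_ge0 ?b0.
rewrite integral_indic//= setIT prob_event -EFinM -big_split/=; congr EFin.
by apply: eq_bigr => j _; rewrite extE.
Qed.

Let truncated_cases K w :
  (exists k : {ffun 'I_m -> 'I_K}, event (ext k) w /\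
      forall b, truncated K b w = \prod_(j < m) b j ^+ k j) \/
  (forall b, truncated K b w = 0).
Proof.
have [[k kw]|nk] := pselect (exists k : {ffun 'I_m -> 'I_K}, event (ext k) w).
  left; exists k; split => // b; rewrite /truncated (bigD1 k)//= [X in _ + X]big1 ?addr0.
    by rewrite indicE mem_set// mulr1.
  move=> k' k'k; rewrite indicE memNset ?mulr0// => k'w; move/eqP: k'k; apply.
  apply/ffunP => j; apply/val_inj; have := kw _ (ltn_ord j).
  by rewrite k'w// !extE => -[] /eqP; rewrite eqr_nat => /eqP.
right => b; rewrite /truncated big1// => k _; rewrite indicE memNset ?mulr0// => kw.
by apply: nk; exists k.
Qed.

Let u_bounds n w : 0 <= u n w <= 1.
Proof.
by rewrite /u prodr_ge0 ?prodr_ile1//= => j _; have /andP[a0 a1] := a01 (ltn_ord j);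
  rewrite exprn_ge0// exprn_ile1.
Qed.

Let u_nonincreasing w : {homo u^~ w : n k / (n <= k)%N >-> k <= n}.
Proof.
apply/nonincreasing_seqP => n; apply: ler_prod => j _.
have /andP[a0 a1] := a01 (ltn_ord j).
rewrite exprn_ge0//= ler_wiXn2l// /count_points big_ord_recr/= leq_addr//.
Qed.

Let measurable_u n : measurable_fun setT (u n).
Proof.
rewrite /u; apply: measurable_prod => /= j _.
under eq_fun do rewrite pow_count_points.
apply: measurable_prod => i _; apply: measurable_funB => //; apply: measurable_funM => //.
by apply: measurableT_comp; [apply: measurable_indic; exact: (mA (ltn_ord j)).1|exact: mX].
Qed.

Let u_cvg w : u n w @[n --> \oo] --> limn (u^~ w).
Proof.
apply: nonincreasing_is_cvgn => //; exists 0 => _ [n _ <-].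
by have /andP[] := u_bounds n w.
Qed.

Let lim_u_bounds w : 0 <= limn (u^~ w) <= 1.
Proof.
apply/andP; split; [apply: limr_ge|apply: limr_le] => //; try exact: u_cvg.
  by apply: nearW => n; have /andP[] := u_bounds n w.
by apply: nearW => n; have /andP[] := u_bounds n w.
Qed.

(** With all powers replaced by 1, [truncated] is the indicator that every count is below [K]. On
    that event the limit is known exactly; elsewhere it lies in [0, 1], which bounds the error. *)
Let u_truncated K w : truncated K a w <= limn (u^~ w) <= truncated K a w + (1 - truncated K (fun=> 1) w).
Proof.
have [[k [kw trE]]|trE] := truncated_cases K w; last first.
  by rewrite !trE subr0 add0r lim_u_bounds.
rewrite !trE [X in 1 - X]big1 ?subrr ?addr0; last by move=> j _; rewrite expr1n.
suff -> : limn (u^~ w) = \prod_(j < m) a j ^+ k j by rewrite lexx.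
apply/cvg_lim => //; under [X in _ --> X]eq_bigr do rewrite -extE.
apply: (@cvg_prod_ord _ _ (fun j n => a j ^+ count_points X n (A j) w) (fun j => a j ^+ ext k j)) => j jm.
apply: cvg_near_cst; have := count_points_eventually (kw j jm).
by apply: filterS => n ->.
Qed.

(** Dominated convergence reduces the claim to the integral of the pointwise limit, which lies
    between [S K a] and [S K a + (1 - S K 1)] for every [K]. The total Poisson mass being 1, the gap
    closes; this is also where the counts are seen to be almost surely finite. *)
Lemma simple_generating_functional :
  (\int[P]_w (\prod_(j < m) a j ^+ count_points X n (A j) w)%:E)%E @[n --> \oo] -->
  ((\prod_(j < m) expR (- (lambda * fine (area (A j)) * (1 - a j))))%:E : \bar R).
Proof.
pose L w := limn (u^~ w).
have mL : measurable_fun setT L.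
  apply: (measurable_fun_cvg (h := u)) => // w _; exact: u_cvg.
have intL : (\int[P]_w (u n w)%:E)%E @[n --> \oo] --> (\int[P]_w (L w)%:E)%E.
  apply: (@dominated_cvg _ _ _ P setT measurableT _ _ (cst 1%E)) => //.
  - by move=> n; apply/measurable_EFinP; exact: measurable_u.
  - by move=> w _; apply: cvg_EFin; [exact: nearW|exact: u_cvg].
  - exact: finite_measure_integrable_cst.
  - move=> n w _ /=; have /andP[u0 u1] := u_bounds n w.
    by rewrite lee_fin ger0_norm.
suff -> : (\prod_(j < m) expR (- (lambda * fine (area (A j)) * (1 - a j))))%:E =
   (\int[P]_w (L w)%:E)%E by [].
have a0 j : (j < m)%N -> 0 <= a j by move=> /a01/andP[].
have tr0 K b w : (forall j, (j < m)%N -> 0 <= b j) -> 0 <= truncated K b w.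
  by move=> b0; rewrite sumr_ge0// => k _; rewrite mulr_ge0// prodr_ge0// => j _; rewrite exprn_ge0 ?b0.
have lo K : ((S K a)%:E <= \int[P]_w (L w)%:E)%E.
  rewrite -integral_truncated//; apply: ge0_le_integral => //.
  - by move=> w _; rewrite lee_fin tr0.
  - by apply/measurable_EFinP; exact: measurable_truncated.
  - by apply/measurable_EFinP.
  - by move=> w _; rewrite lee_fin; have /andP[] := u_truncated K w.
have hi K : (\int[P]_w (L w)%:E + (S K (fun=> 1))%:E <= (S K a)%:E + 1)%E.
  have L0 w : (0 <= (L w)%:E)%E by rewrite lee_fin; have /andP[] := lim_u_bounds w.
  have one : (\int[P]_w (1 : \bar R) = 1)%E.
    by rewrite integral_cst// mul1e; exact: probability_setT.
  rewrite -!integral_truncated// -[X in (_ <= _ + X)%E]one.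
  rewrite -ge0_integralD//; last 3 first.
  - by apply/measurable_EFinP.
  - by move=> w _; rewrite lee_fin tr0.
  - by apply/measurable_EFinP; exact: measurable_truncated.
  rewrite -ge0_integralD//; last 2 first.
  - by move=> w _; rewrite lee_fin tr0.
  - by apply/measurable_EFinP; exact: measurable_truncated.
  apply: ge0_le_integral => //.
  - by move=> w _; rewrite adde_ge0// lee_fin tr0.
  - by apply: emeasurable_funD; apply/measurable_EFinP => //; exact: measurable_truncated.
  - by apply: emeasurable_funD => //; apply/measurable_EFinP => //; exact: measurable_truncated.
  - move=> w _; rewrite -!EFinD lee_fin.
    by have /andP[_] := u_truncated K w; rewrite addrA lerBrDr.
have [l lE] : exists l, (\int[P]_w (L w)%:E)%E = l%:E.
  exists (fine (\int[P]_w (L w)%:E)%E); rewrite fineK// ge0_fin_numE.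
    have := hi 0%N; by case: (\int[P]_w _)%E => // r _; rewrite ltry.
  by apply: integral_ge0 => w _; rewrite lee_fin; have /andP[] := lim_u_bounds w.
(* The sandwiched integral does not depend on [K]: as a constant sequence it converges both to
   itself and to the common limit of the bounds. *)
rewrite lE; congr EFin; apply/esym; apply: (@cvg_unique _ _ (cst l @ \oo)) => //.
  exact: cvg_cst.
apply: (@squeeze_cvgr _ _ _ _ (fun K => S K a) (fun K => S K a + (1 - S K (fun=> 1)))).
- apply: nearW => K /=; apply/andP; split; first by have := lo K; rewrite lE lee_fin.
  by have := hi K; rewrite lE -!EFinD lee_fin addrA lerBrDr.
- exact: S_cvg.
- rewrite -[X in _ --> X]addr0; apply: cvgD; first exact: S_cvg.
  rewrite -(subrr 1); apply: cvgB; first exact: cvg_cst.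
  have := @S_cvg (fun=> 1); rewrite [X in _ --> X -> _]big1//.
  by move=> j _; rewrite subrr mulr0 oppr0 expR0.
Qed.

End simple_functional.

Section bounded_simple_functional.
Context d (T : measurableType d) (R : realType) (P : probability T R).
Context (lambda : R) (X : nat -> T -> plane R).
Hypothesis mX : forall i, measurable_fun setT (X i).
Hypothesis XP : is_PPP (fun E => fine (P E)) lambda X.
Context (h : {nnsfun plane R >-> R}) (D : set (plane R)).
Hypotheses (h1 : forall z, h z <= 1) (mD : measurable D) (Dfin : (area D < +oo)%E).

Let s : seq R := enum_fset (fset_set (range h)).
Let A (j : nat) : set (plane R) := h @^-1` [set s`_j] `&` D.

Let s_uniq : uniq s. Proof. exact: fset_uniq. Qed.

Let s_mem j : (j < size s)%N -> range h s`_j.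
Proof.
move=> js; have : s`_j \in fset_set (range h) by rewrite -/(enum_fset _) mem_nth.
by rewrite in_fset_set//; exact: set_mem.
Qed.

Let mA j : measurable (A j).
Proof.
by apply: measurableI => //; rewrite -[X in measurable X]setTI.
Qed.

Let A_fin j : (area (A j) < +oo)%E.
Proof.
apply: le_lt_trans Dfin; rewrite /area; apply: le_measure.
- by apply: mem_set; exact: mA.
- exact: mem_set.
- exact: subIsetr.
Qed.

Let s01 j : (j < size s)%N -> 0 <= s`_j <= 1.
Proof. by move=> /s_mem[z _ <-]; rewrite h1 andbT. Qed.

Let level z : D z -> exists2 j : 'I_(size s), h z = s`_j &
  forall i : 'I_(size s), \1_(A i) z = (i == j)%:R :> R.
Proof.
move=> Dz; have hz : h z \in s.
  have : h z \in fset_set (range h) by rewrite in_fset_set//; apply/mem_set; exists z.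
  by [].
have js : (index (h z) s < size s)%N by rewrite index_mem.
exists (Ordinal js) => /=; first by rewrite nth_index.
move=> i; rewrite indicE; congr (_%:R); congr nat_of_bool; apply/idP/eqP.
  move=> /set_mem[/= hzi _]; apply/val_inj => /=.
  by rewrite hzi index_uniq.
by move=> ->; apply/mem_set; split => //=; rewrite nth_index.
Qed.

Let prod_level z : \prod_(j < size s) (1 - s`_j * \1_(A j) z) = 1 - h z * \1_D z.
Proof.
rewrite [\1_D z]indicE; have [Dz|Dz] := boolP (z \in D); last first.
  rewrite mulr0 subr0 big1// => j _; rewrite indicE memNset ?mulr0 ?subr0//.
  by move=> [_ /mem_set]; rewrite (negbTE Dz).
have [j hzj ind] := level (set_mem Dz).
rewrite (bigD1 j)//= ind eqxx mulr1 hzj [X in _ * X]big1 ?mulr1// => i ij.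
by rewrite ind (negbTE ij) mulr0 subr0.
Qed.

Let sum_level z : \sum_(j < size s) s`_j * \1_(A j) z = h z * \1_D z.
Proof.
rewrite [\1_D z]indicE; have [Dz|Dz] := boolP (z \in D); last first.
  rewrite mulr0 big1// => j _; rewrite indicE memNset ?mulr0//.
  by move=> [_ /mem_set]; rewrite (negbTE Dz).
have [j hzj ind] := level (set_mem Dz).
rewrite (bigD1 j)//= ind eqxx mulr1 hzj [X in _ + X]big1 ?addr0 ?mulr1// => i ij.
by rewrite ind (negbTE ij) mulr0.
Qed.

(** A point belongs to at most one level set of [h] inside [D], so [1 - h] there is a product over
    the levels with bases [a j = 1 - s_j]; exchanging the products over points and levels gives
    powers of counts. *)
Lemma bounded_simple_generating_functional :
  (\int[P]_w (\prod_(i < n) (1 - h (X i w) * \1_D (X i w)))%:E)%E @[n --> \oo] -->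
  expeR (- (lambda%:E * \int[@area R]_z (h z * \1_D z)%:E)%E).
Proof.
have tA : trivIset `I_(size s) A.
  move=> i j /= im jm [z [[/= hi _] [hj _]]].
  by apply/eqP; rewrite -(nth_uniq 0 im jm s_uniq) -hi -hj.
have := @simple_generating_functional _ _ _ P lambda X mX XP (size s) A
  (fun j => 1 - s`_j) (fun j _ => conj (mA j) (A_fin j)) tA.
have a01 j : (j < size s)%N -> 0 <= 1 - s`_j <= 1.
  by move=> /s01/andP[s0 s1]; rewrite subr_ge0 s1 lerBlDr lerDl.
move=> /(_ a01).
under eq_fun => n.
  under eq_integral => w _.
    under eq_bigr do rewrite pow_count_points.
    rewrite exchange_big/=.
    under eq_bigr => i _.
      under eq_bigr do rewrite subKr.
      rewrite prod_level.
      over.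
    over.
  over.
suff -> : (\prod_(j < size s) expR (- (lambda * fine (area (A j)) * (1 - (1 - s`_j)))))%:E =
   expeR (- (lambda%:E * \int[@area R]_z (h z * \1_D z)%:E)%E) by [].
have -> : (\int[@area R]_z (h z * \1_D z)%:E)%E =
   (\sum_(j < size s) s`_j * fine (area (A j)))%:E.
  under eq_integral do rewrite -sum_level -sumEFin.
  rewrite ge0_integral_sum//; last 2 first.
  - by move=> j; apply/measurable_EFinP; apply: measurable_funM => //; exact: measurable_indic.
  - by move=> j z _; rewrite lee_fin mulr_ge0//; have /andP[] := s01 (ltn_ord j).
  rewrite -sumEFin; apply: eq_bigr => j _.
  under eq_integral do rewrite EFinM.
  rewrite ge0_integralZl_EFin//; last 2 first.
  - by apply/measurable_EFinP; exact: measurable_indic.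
  - by have /andP[] := s01 (ltn_ord j).
  rewrite integral_indic//= setIT EFinM fineK// ge0_fin_numE ?A_fin//.
rewrite -EFinM -EFinN/= -expR_sum; congr (expR _)%:E.
by rewrite mulr_sumr sumrN; congr (- _); apply: eq_bigr => j _; ring.
Qed.

End bounded_simple_functional.

Section generating_functional.
Context (R : realType).

(** Exhausts the plane by sets of finite area, the only ones on which the law of the process is
    prescribed. *)
Definition box (k : nat) : set (plane R) := `[- k%:R, k%:R] `*` `[- k%:R, k%:R].

Lemma measurable_box k : measurable (box k).
Proof. by apply: measurableX; exact: measurable_itv. Qed.

Lemma area_box_fin k : (area (box k) < +oo)%E.
Proof.
rewrite /area/= product_measure1E; try exact: measurable_itv.
by rewrite /= lebesgue_measure_itv/=; case: ifP => _; rewrite ?mule0 -?EFinD -?EFinM ltry.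
Qed.

Lemma box_nondecreasing (k l : nat) (z : plane R) : (k <= l)%N -> box k z -> box l z.
Proof.
move=> kl [/= ]; rewrite !in_itv/= => /andP[? ?] /andP[? ?].
have : (k%:R <= l%:R :> R) by rewrite ler_nat.
by move=> ?; split; rewrite /= in_itv/=; apply/andP; split; lra.
Qed.

Lemma box_eventually (z : plane R) : \forall k \near \oo, box k z.
Proof.
near=> k.
have h1 : `|z.1| <= k%:R by near: k; exact: nbhs_infty_ger.
have h2 : `|z.2| <= k%:R by near: k; exact: nbhs_infty_ger.
by split; rewrite /= in_itv/= -ler_norml.
Unshelve. all: by end_near. Qed.

Context d (T : measurableType d) (P : probability T R).
Context (lambda : R) (lambda_gt0 : 0 < lambda) (X : nat -> T -> plane R).
Hypothesis mX : forall i, measurable_fun setT (X i).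
Hypothesis XP : is_PPP (fun E => fine (P E)) lambda X.
Context (F : plane R -> R).
Hypotheses (mF : measurable_fun setT F) (F01 : forall z, 0 <= F z <= 1).

Let f z := (1 - F z)%:E.
Let mf : measurable_fun setT f.
Proof. by apply/measurable_EFinP; exact: measurable_funB. Qed.
Let f0 z : (0 <= f z)%E.
Proof. by rewrite lee_fin subr_ge0; have /andP[] := F01 z. Qed.

Let h k := nnsfun_approx measurableT mf k.
(** Simple functions supported in boxes that increase to [1 - F]. *)
Let psi k z : R := h k z * \1_(box k) z.

Let h_cvg z : h k z @[k --> \oo] --> 1 - F z.
Proof.
have := @cvg_nnsfun_approx _ _ _ setT measurableT f mf (fun z _ => f0 z) z Logic.I.
exact: fine_cvg.
Qed.

Let h_le k z : h k z <= 1.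
Proof.
apply: (@le_trans _ _ (1 - F z)); last by rewrite lerBlDr lerDl; have /andP[] := F01 z.
have hc := @h_cvg z; rewrite -(cvg_lim _ hc)//.
apply: (@nondecreasing_cvgn_le _ (fun k => h k z)); last by apply/cvg_ex; exists (1 - F z).
by move=> k' l kl; exact/lefP/nd_nnsfun_approx.
Qed.

Let psi_cvg z : psi k z @[k --> \oo] --> 1 - F z.
Proof.
rewrite -[X in _ --> X]mulr1; apply: cvgM; first exact: h_cvg.
apply: cvg_near_cst; have := box_eventually z; apply: filterS => k zk.
by rewrite indicE mem_set.
Qed.

Let psi_nd z : {homo psi^~ z : k l / (k <= l)%N >-> k <= l}.
Proof.
move=> k l kl; rewrite /psi; apply: ler_pM => //.
  exact/lefP/nd_nnsfun_approx.
rewrite !indicE ler_nat; case: (boolP (_ \in box k)) => //= /set_mem zk.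
by rewrite mem_set//; exact: box_nondecreasing zk.
Qed.

Let psi01 k z : 0 <= psi k z <= 1.
Proof.
by rewrite mulr_ge0//= -[leRHS]mulr1 ler_pM// indicE; case: (_ \in _).
Qed.

Let psi_le k z : psi k z <= 1 - F z.
Proof.
have pc := @psi_cvg z; rewrite -(cvg_lim _ pc)//.
apply: (@nondecreasing_cvgn_le _ (fun k => psi k z)); last by apply/cvg_ex; exists (1 - F z).
exact: psi_nd.
Qed.

Let measurable_psi k : measurable_fun setT (psi k).
Proof. by apply: measurable_funM => //; apply: measurable_indic; exact: measurable_box. Qed.

Let u n k := (\int[P]_w (\prod_(i < n) (1 - psi k (X i w)))%:E)%E.
Let v n := (\int[P]_w (\prod_(i < n) F (X i w))%:E)%E.
Let c k := expeR (- (lambda%:E * \int[@area R]_z (psi k z)%:E)%E).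

Let u_cvg k : u n k @[n --> \oo] --> c k.
Proof. exact: (bounded_simple_generating_functional mX XP (h_le k) (measurable_box k) (area_box_fin k)). Qed.

Let prod01 n (G : plane R -> R) w : (forall z, 0 <= G z <= 1) ->
  0 <= \prod_(i < n) G (X i w) <= 1.
Proof.
by move=> G01; rewrite prodr_ge0 ?prodr_ile1//= => i _; have /andP[] := G01 (X i w).
Qed.

Let measurable_prodX n (G : plane R -> R) : measurable_fun setT G ->
  measurable_fun setT (fun w => (\prod_(i < n) G (X i w))%:E).
Proof.
move=> mG; apply/measurable_EFinP; apply: measurable_prod => /= i _.
exact: (measurableT_comp mG (mX i)).
Qed.

Let Npsi01 k z : 0 <= 1 - psi k z <= 1.
Proof. by have /andP[p0 p1] := psi01 k z; rewrite subr_ge0 p1 lerBlDr lerDl. Qed.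

Let measurable_Npsi k : measurable_fun setT (fun z => 1 - psi k z).
Proof. exact: measurable_funB. Qed.

Let v_cvg n : u n k @[k --> \oo] --> v n.
Proof.
apply: (@dominated_cvg _ _ _ P setT measurableT _ _ (cst 1%E)) => //.
- by move=> k; exact: (measurable_prodX _ (measurable_Npsi k)).
- move=> w _; apply: cvg_EFin; first exact: nearW.
  apply: (@cvg_prod_ord _ _ (fun i k => 1 - psi k (X i w)) (fun i => F (X i w))) => i _.
  rewrite -[X in _ --> X](subKr 1); apply: cvgB; [exact: cvg_cst|exact: psi_cvg].
- exact: finite_measure_integrable_cst.
- move=> k w _ /=; have /andP[u0 u1] := prod01 n w (Npsi01 k).
  by rewrite lee_fin ger0_norm.
Qed.

Let c_ge k : (expeR (- (lambda%:E * \int[@area R]_z (1 - F z)%:E)) <= c k)%E.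
Proof.
rewrite lee_expeR leeN2; apply: lee_wpmul2l; first by rewrite lee_fin ltW.
apply: ge0_le_integral => //.
- by move=> z _; rewrite lee_fin; have /andP[] := psi01 k z.
- exact/measurable_EFinP.
- by move=> z _; rewrite lee_fin.
Qed.

Let v_le_u n k : (v n <= u n k)%E.
Proof.
apply: ge0_le_integral => //.
- by move=> w _; rewrite lee_fin; have /andP[] := prod01 n w F01.
- exact: measurable_prodX.
- exact: (measurable_prodX _ (measurable_Npsi k)).
- move=> w _; rewrite lee_fin; apply: ler_prod => i _.
  have := psi_le k (X i w); have /andP[-> _] := F01 (X i w).
  by rewrite lerBrDr addrC -lerBrDr.
Qed.

Let ni_prod (G : plane R -> R) : measurable_fun setT G -> (forall z, 0 <= G z <= 1) ->
  {homo (fun n => \int[P]_w (\prod_(i < n) G (X i w))%:E)%E : n l / (n <= l)%N >-> (l <= n)%E}.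
Proof.
move=> mG G01; apply/nonincreasing_seqP => n; apply: ge0_le_integral => //.
- by move=> w _; rewrite lee_fin; have /andP[] := prod01 n.+1 w G01.
- exact: measurable_prodX.
- exact: measurable_prodX.
- move=> w _; rewrite lee_fin big_ord_recr/= ler_piMr//.
    by have /andP[] := prod01 n w G01.
  by have /andP[] := G01 (X n w).
Qed.

(** The limits in [n] (points) and [k] (approximation) are exchanged by monotonicity. From below,
    [u n k] decreases in [n] to [c k], which dominates the target, and then [k] tends to infinity.
    From above, [v n <= u n k] gives [limn v <= c k] for every [k]. *)
Lemma generating_functional : v n @[n --> \oo] -->
  expeR (- (lambda%:E * \int[@area R]_z (1 - F z)%:E)%E).
Proof.
have v_is_cvg : cvgn v by apply: ereal_nonincreasing_is_cvgn; exact: ni_prod.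
suff <- : limn v = expeR (- (lambda%:E * \int[@area R]_z (1 - F z)%:E)%E) by [].
apply/eqP; rewrite eq_le; apply/andP; split; last first.
  apply: lime_ge => //; apply: nearW => n; rewrite -(cvg_lim _ (@v_cvg n))//.
  apply: lime_ge; first by apply/cvg_ex; exists (v n); exact: v_cvg.
  apply: nearW => k; apply: (le_trans (c_ge k)); rewrite -(cvg_lim _ (@u_cvg k))//.
  apply: lime_le; first by apply/cvg_ex; exists (c k); exact: u_cvg.
  exists n => // l /= nl; exact: (ni_prod (measurable_Npsi k) (Npsi01 k)).
have v_le_c k : (limn v <= c k)%E.
  rewrite -(cvg_lim _ (@u_cvg k))//; apply: lee_lim => //.
    by apply/cvg_ex; exists (c k); exact: u_cvg.
  exact: nearW.
(* Exponents are compared rather than exponentials: monotone convergence of the integrals of [psi]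
   then also covers an infinite integral, where the target is 0. *)
have [y yE] : exists y, expeR y = limn v.
  apply: expeR_total; apply: lime_ge => //; apply: nearW => n.
  by apply: integral_ge0 => w _; rewrite lee_fin; have /andP[] := prod01 n w F01.
have {}v_le_c k : (y <= - (lambda%:E * \int[@area R]_z (psi k z)%:E))%E.
  by rewrite -lee_expeR yE; exact: v_le_c.
rewrite -yE lee_expeR.
have psilim : (\int[@area R]_z (lambda%:E * (psi k z)%:E))%E @[k --> \oo] -->
    (\int[@area R]_z (lambda%:E * (1 - F z)%:E))%E.
  have -> : (\int[@area R]_z (lambda%:E * (1 - F z)%:E) =
     \int[@area R]_z limn (fun k => lambda%:E * (psi k z)%:E))%E.
    apply: eq_integral => z _; apply/esym/cvg_lim => //; rewrite -EFinM.
    apply: cvg_EFin; first exact: nearW.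
    by apply: cvgMr; exact: psi_cvg.
  apply: cvg_monotone_convergence => //.
  - by move=> k; apply: measurable_funeM; exact/measurable_EFinP.
  - move=> k z _; have /andP[p0 _] := psi01 k z.
    by rewrite mule_ge0 ?lee_fin// ltW.
  - move=> z _ k l kl; apply: lee_wpmul2l; first by rewrite lee_fin ltW.
    by rewrite lee_fin; exact: psi_nd.
have pull (G : plane R -> R) : measurable_fun setT G -> (forall z, 0 <= G z) ->
    (\int[@area R]_z (lambda%:E * (G z)%:E) = lambda%:E * \int[@area R]_z (G z)%:E)%E.
  move=> mG G0; rewrite ge0_integralZl_EFin//.
  - by move=> z _; rewrite lee_fin.
  - exact/measurable_EFinP.
  - exact: ltW.
rewrite -pull; last 2 first.
- exact: measurable_funB.
- by move=> z; rewrite subr_ge0; have /andP[] := F01 z.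
rewrite leeNr -(cvg_lim _ psilim)//; apply: lime_le.
  by apply/cvg_ex; eexists; exact: psilim.
apply: nearW => k; rewrite pull//; first by rewrite leeNr.
by move=> z; have /andP[] := psi01 k z.
Qed.

End generating_functional.

(** * Integrating out exponential fadings *)

Definition unit_exponential (R : realType) : probability (measurableTypeR R) R.
Proof. refine [the probability _ _ of @exponential_prob R 1]; exact: ltr01. Defined.

Section exponential_integrals.
Context (R : realType).
Local Notation mu := (@lebesgue_measure R).

Lemma exponential_tail (y : R) : 0 <= y ->
  exponential_prob 1 [set h | y < h] = (expR (- y))%:E.
Proof.
move=> y0; rewrite /exponential_prob.
have -> : [set h : R | y < h] = `]y, +oo[%classic.
  by apply/seteqP; split => h /=; rewrite in_itv/= andbT.
have mpdf := measurable_exponential_pdf (R := R) 1.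
rewrite integral_itv_obnd_cbnd; last by apply/measurable_EFinP; exact: measurable_funTS.
rewrite (@ge0_continuous_FTC2y _ _ (fun x => - (expR (- 1 * x))) _ 0)//.
- by rewrite mulN1r EFinN oppeK add0e.
- by move=> x _; exact: exponential_pdf_ge0.
- apply: (@continuous_subspaceW R^o _ _ [set` `[0, +oo[%R]).
  + by apply: subset_itvr; rewrite bnd_simp.
  + exact: within_continuous_exponential_pdf.
- rewrite -oppr0; apply: cvgN; under eq_fun do rewrite mulN1r.
  exact: cvgr_expR.
- apply: cvg_at_right_filter; apply: cvgN.
  by apply: continuous_comp; [exact: mulrl_continuous|exact: continuous_expR].
- move=> x xy; apply: derive1_exponential_pdf.
  by move: xy; rewrite !in_itv/= !andbT => /(le_lt_trans y0).
Qed.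

(** The integrand times the density of rate 1 is [(1 + b)^-1] times the density of rate [1 + b]. *)
Lemma exponential_laplace (b : R) : 0 <= b ->
  (\int[unit_exponential R]_h (expR (- (b * h)))%:E = ((1 + b)^-1)%:E)%E.
Proof.
move=> b0.
have b1 : 0 < 1 + b by rewrite ltr_pwDl.
have mpdf := measurable_exponential_pdf (R := R).
have pdf0 c x : 0 <= c -> 0 <= exponential_pdf (R := R) c x by move=> ?; exact: exponential_pdf_ge0.
have mexp : measurable_fun setT (fun h : R => (expR (- (b * h)))%:E).
  apply/measurable_EFinP; apply: (measurableT_comp (@measurable_expR R)).
  by apply: (measurableT_comp (@oppr_measurable R setT)); exact: mulrl_measurable.
transitivity (\int[density_measure mu (exponential_pdf 1)]_h (expR (- (b * h)))%:E)%E.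
  have mpdf1 := mpdf 1; have pdf10 x := pdf0 1 x ler01.
  by apply: eq_measure_integral.
rewrite integral_density_measure//; last 2 first.
- exact: mpdf.
- by move=> x; exact: pdf0.
transitivity (\int[mu]_x (((1 + b)^-1)%:E * (exponential_pdf (1 + b) x)%:E))%E.
  apply: eq_integral => x _; rewrite -!EFinM; congr EFin.
  rewrite /exponential_pdf !patchE; case: ifP => _; rewrite ?mulr0//.
  rewrite mul1r mulrA mulVf ?gt_eqF// mul1r -expRD; congr expR; ring.
rewrite ge0_integralZl_EFin//.
- by rewrite integral_exponential_pdf// mule1.
- by move=> x _; rewrite lee_fin pdf0// ltW.
- by apply/measurable_EFinP; exact: mpdf.
- by rewrite invr_ge0 ltW.
Qed.

End exponential_integrals.

(** For fixed [K] both sides are finite measures in [E], so agreement on a family closed under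
    intersection extends to the sigma-algebra it generates. *)
Lemma indep_g_sigma d (T : measurableType d) (R : realType) (P : probability T R)
    (G : set (set T)) (K : set T) (c : {nonneg R}) :
  G `<=` measurable -> setI_closed G -> G setT -> measurable K ->
  (forall E, G E -> P (E `&` K) = c%:num%:E * P E)%E ->
  forall E, <<s G >> E -> P (E `&` K) = (c%:num%:E * P E)%E.
Proof.
move=> Gm GI GT mK hG E GE.
apply: (@g_sigma_algebra_measure_unique _ R _ G Gm (fun=> setT) (fun=> GT) _
  (mrestr P mK) (mscale c P) GI _ _ E GE).
- by rewrite bigcup_const.
- by move=> A GA; exact: hG.
- by move=> _; change (P (setT `&` K) < +oo)%E; rewrite setTI ltey_eq fin_num_measure.
Qed.

Section fading.
Context d (T : measurableType d) (R : realType) (P : probability T R).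
Context (G : set (set T)) (Gm : G `<=` measurable).
Context (H0 : T -> R) (H : nat -> T -> R).
Hypotheses (mH0 : measurable_fun setT (H0 : T -> measurableTypeR R))
  (mH : forall i, measurable_fun setT (H i : T -> measurableTypeR R)).
Hypothesis H_ge0 : forall i w, 0 <= H i w.
Local Notation nu := (unit_exponential R).
Local Notation GT := (g_sigma_algebraType G).
Hypothesis law : forall n E (U0 : set (measurableTypeR R)) (U : nat -> set (measurableTypeR R)),
  <<s G >> E -> measurable U0 -> (forall i, measurable (U i)) ->
  (P (E `&` [set w | U0 (H0 w)] `&` [set w | forall i, (i < n)%N -> U i (H i w)]) =
   P E * nu U0 * \prod_(i < n) nu (U i))%E.

(** Rectangles in the events of [G] and the first [n] fadings: a family closed under intersection on
    which [law] evaluates probabilities directly. *)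
Definition past n : set (set T) := [set D | exists E U, [/\ <<s G >> E,
  forall i, measurable (U i : set (measurableTypeR R)) &
  D = E `&` [set w | forall i, (i < n)%N -> U i (H i w)]]].

Let G_measurable E : <<s G >> E -> measurable E.
Proof. by move: E; apply: smallest_sub => //; exact: sigma_algebra_measurable. Qed.

Let measurable_fades n (U : nat -> set (measurableTypeR R)) :
  (forall i, measurable (U i)) ->
  measurable [set w | forall i, (i < n)%N -> U i (H i w)].
Proof.
move=> mU; rewrite (_ : [set _ | _] = \bigcap_(i in `I_n) (H i @^-1` U i)).
  apply: fin_bigcap_measurable => // i _; rewrite -[X in measurable X]setTI.
  exact: (mH i measurableT (mU i)).
by apply/seteqP; split.
Qed.

Lemma past_measurable n : past n `<=` measurable.
Proof.
move=> _ [E [U [GE mU ->]]]; apply: measurableI; first exact: G_measurable.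
exact: measurable_fades.
Qed.

Lemma past_sigma n E : <<s G >> E -> past n E.
Proof.
move=> GE; exists E, (fun=> setT); split => //.
by apply/seteqP; split => // w [].
Qed.

Lemma past_setT n : past n setT.
Proof. by apply: past_sigma; exact: (@measurableT _ GT). Qed.

Lemma past_setI n : setI_closed (past n).
Proof.
move=> _ _ [E [U [GE mU ->]]] [E' [U' [GE' mU' ->]]].
exists (E `&` E'), (fun i => U i `&` U' i); split.
- exact: (@measurableI _ GT).
- by move=> i; exact: measurableI.
- apply/seteqP; split => w /=.
    by move=> [[Ew Uw] [Ew' Uw']]; split => // i ilt; split; [exact: Uw|exact: Uw'].
  by move=> [[Ew Ew'] UUw]; split; split => // i /UUw[].
Qed.

Lemma measurable_past n d' (S : measurableType d') (f : T -> S) :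
  measurable_fun setT (f : GT -> S) ->
  measurable_fun setT (f : g_sigma_algebraType (past n) -> S).
Proof.
move=> mf _ A mA; rewrite setTI; apply: sub_sigma_algebra; apply: past_sigma.
by have := mf measurableT A mA; rewrite setTI.
Qed.

Lemma measurable_fading_past n i : (i < n)%N ->
  measurable_fun setT (H i : g_sigma_algebraType (past n) -> measurableTypeR R).
Proof.
move=> ilt _ A mA; rewrite setTI; apply: sub_sigma_algebra.
exists setT, (fun j => if j == i then A else setT); split.
- exact: (@measurableT _ GT).
- by move=> j; case: ifP.
- apply/seteqP; split => w /=.
    by move=> Aw; split => // j _; case: eqP => // ->.
  by move=> [_ /(_ i ilt)]; rewrite eqxx.
Qed.

Let past_indep n (K : T -> measurableTypeR R) : measurable_fun setT K ->
  (forall D (U : set (measurableTypeR R)), past n D -> measurable U -> P (D `&` K @^-1` U) = (nu U * P D)%E) ->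
  forall D (U : set (measurableTypeR R)), <<s past n >> D -> measurable U -> P (D `&` K @^-1` U) = (P D * nu U)%E.
Proof.
move=> mK hK D U DP mU.
have c0 : 0 <= fine (nu U) by exact: fine_ge0.
have := @indep_g_sigma _ _ _ P (past n) (K @^-1` U) (NngNum c0) (@past_measurable n)
  (@past_setI n) (past_setT n).
rewrite /= fineK ?fin_num_measure// muleC; apply => //.
  by rewrite -[X in measurable X]setTI; exact: mK.
by move=> E PE; exact: hK.
Qed.

Lemma given_fading_indep n D (U : set (measurableTypeR R)) : <<s past n >> D -> measurable U ->
  P (D `&` H0 @^-1` U) = (P D * nu U)%E.
Proof.
apply: past_indep => // {D U} _ U [E [V [GE mV ->]]] mU.
have := law n GE mU mV; have := law n GE measurableT mV.
rewrite probability_setT mule1 (_ : [set w | setT (H0 w)] = setT); last by apply/seteqP.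
rewrite setIT => -> lawU.
by rewrite setIAC [LHS]lawU [(P E * _)%E]muleC muleA.
Qed.

(** On a rectangle this is [law] for [n.+1] fadings, with [U] inserted as the constraint of index
    [n], divided into [law] for [n]. *)
Lemma next_fading_indep n D (U : set (measurableTypeR R)) : <<s past n >> D -> measurable U ->
  P (D `&` H n @^-1` U) = (P D * nu U)%E.
Proof.
apply: past_indep => // {D U} _ U [E [V [GE mV ->]]] mU.
pose V' i := if i == n then U else V i.
have mV' i : measurable (V' i) by rewrite /V'; case: ifP.
have := law n.+1 GE measurableT mV'; have := law n GE measurableT mV.
rewrite probability_setT mule1 (_ : [set w | setT (H0 w)] = setT); last by apply/seteqP.
rewrite setIT => ->.
have V'n : V' n = U by rewrite /V' eqxx.
have V'lt i : (i < n)%N -> V' i = V i by move=> ilt; rewrite /V' ltn_eqF.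
rewrite big_ord_recr/= V'n (eq_bigr (fun i : 'I_n => nu (V i))); last first.
  by move=> i _; rewrite V'lt.
rewrite muleA [RHS]muleC => <-; congr (P _); rewrite -setIA; congr setI.
apply/seteqP; split => w /=.
  move=> [Vw Uw] i; rewrite ltnS leq_eqVlt => /orP[/eqP ->|ilt]; first by rewrite V'n.
  by rewrite V'lt//; exact: Vw.
move=> Vw; split; last by have := Vw n (ltnSn n); rewrite V'n.
by move=> i ilt; have := Vw i (ltnW ilt); rewrite V'lt.
Qed.

Lemma integral_next_fading n (f : T -> \bar R) (b : T -> R) :
  measurable_fun setT (f : g_sigma_algebraType (past n) -> \bar R) -> (forall w, 0 <= f w)%E ->
  measurable_fun setT (b : GT -> R) -> (forall w, 0 <= b w) ->
  (\int[P]_w (f w * (expR (- (b w * H n w)))%:E) = \int[P]_w (f w * ((1 + b w)^-1)%:E))%E.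
Proof.
move=> mf f0 mb b0.
pose F (x : g_sigma_algebraType (past n) * measurableTypeR R) : \bar R :=
  (f x.1 * (expR (- (b x.1 * x.2)))%:E)%E.
have mF : measurable_fun setT F.
  apply: emeasurable_funM; first exact: (measurableT_comp mf measurable_fst).
  apply/measurable_EFinP; apply: (measurableT_comp (@measurable_expR R)).
  apply: (measurableT_comp (@oppr_measurable R setT)); apply: measurable_funM => //.
  exact: (measurableT_comp (measurable_past (n := n) mb) measurable_fst).
have F0 x : (0 <= F x)%E by rewrite mule_ge0// lee_fin expR_ge0.
rewrite (@independent_integral _ T R P (past n) (@past_measurable n) _ (measurableTypeR R) (H n) nu (mH n) (@next_fading_indep n) F mF F0).
apply: eq_integral => w _; rewrite /F/= ge0_integralZl//.
- by rewrite exponential_laplace.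
- apply/measurable_EFinP; apply: (measurableT_comp (@measurable_expR R)).
  by apply: (measurableT_comp (@oppr_measurable R setT)); exact: mulrl_measurable.
Qed.

(** Induction on [n] for all weights [g]: the last fading is independent of the earlier ones, and
    the factor it leaves is measurable for [G] alone, so it joins [g]. *)
Lemma integral_fading n (g : T -> \bar R) (b : nat -> T -> R) :
  measurable_fun setT (g : GT -> \bar R) -> (forall w, 0 <= g w)%E ->
  (forall i, measurable_fun setT (b i : GT -> R)) -> (forall i w, 0 <= b i w) ->
  (\int[P]_w (g w * (\prod_(i < n) expR (- (b i w * H i w)))%:E) =
   \int[P]_w (g w * (\prod_(i < n) (1 + b i w)^-1)%:E))%E.
Proof.
move=> + + mb b0; elim: n g => [|n IH] g mg g0.
  by apply: eq_integral => w _; rewrite !big_ord0.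
have mb' i : measurable_fun setT (fun w : GT => (1 + b i w)^-1).
  rewrite (_ : (fun w => _) = fun w => (1 + b i w) `^ (-1)).
    by apply: (measurableT_comp (@measurable_powR R (-1))); exact: measurable_funD.
  by apply/funext => w; rewrite powR_inv1// addr_ge0.
transitivity (\int[P]_w ((g w * (\prod_(i < n) expR (- (b i w * H i w)))%:E) *
    (expR (- (b n w * H n w)))%:E))%E.
  by apply: eq_integral => w _; rewrite big_ord_recr/= EFinM muleA.
rewrite integral_next_fading//; last 2 first.
- apply: emeasurable_funM; first exact: measurable_past.
  apply/measurable_EFinP; apply: measurable_prod => /= i _.
  apply: (measurableT_comp (@measurable_expR R)).
  apply: (measurableT_comp (@oppr_measurable R setT)); apply: measurable_funM.
    exact: measurable_past.
  exact: measurable_fading_past.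
- by move=> w; rewrite mule_ge0// lee_fin prodr_ge0// => i _; exact: expR_ge0.
transitivity (\int[P]_w ((g w * ((1 + b n w)^-1)%:E) *
    (\prod_(i < n) expR (- (b i w * H i w)))%:E))%E.
  by apply: eq_integral => w _; rewrite muleAC.
rewrite IH.
- apply: eq_integral => w _; rewrite big_ord_recr/= EFinM muleA muleAC.
  by rewrite -!muleA; congr (_ * _)%E; rewrite muleC.
- by apply: emeasurable_funM => //; exact/measurable_EFinP.
- by move=> w; rewrite mule_ge0// lee_fin invr_ge0 addr_ge0.
Qed.

(** The exponential tail turns exceeding the threshold into the exponential of minus the threshold,
    which factors over the stations and leaves one Laplace transform per fading. *)
Lemma integral_given_fading n (y : R) (g : T -> \bar R) (b : nat -> T -> R) : 0 <= y ->
  measurable_fun setT (g : GT -> \bar R) -> (forall w, 0 <= g w)%E ->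
  (forall i, measurable_fun setT (b i : GT -> R)) -> (forall i w, 0 <= b i w) ->
  (\int[P]_w (g w * (\1_[set w | y + \sum_(i < n) b i w * H i w < H0 w] w)%:E) =
   (expR (- y))%:E * \int[P]_w (g w * (\prod_(i < n) (1 + b i w)^-1)%:E))%E.
Proof.
move=> y0 mg g0 mb b0.
pose Y (w : T) := y + \sum_(i < n) b i w * H i w.
have Y0 w : 0 <= Y w by rewrite addr_ge0// sumr_ge0// => i _; rewrite mulr_ge0.
have mY : measurable_fun setT (Y : g_sigma_algebraType (past n) -> R).
  apply: measurable_funD => //; apply: measurable_sum => i; apply: measurable_funM.
    exact: measurable_past.
  exact: measurable_fading_past.
pose F (x : g_sigma_algebraType (past n) * measurableTypeR R) : \bar R :=
  (g x.1 * (\1_[set z : g_sigma_algebraType (past n) * measurableTypeR R | Y z.1 < z.2] x)%:E)%E.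
have mF : measurable_fun setT F.
  apply: emeasurable_funM; first exact: (measurableT_comp (measurable_past (n := n) mg) measurable_fst).
  apply/measurable_EFinP; apply: measurable_indic.
  rewrite -[X in measurable X]setTI.
  have := @measurable_fun_ltr _ _ _ setT _ _ (measurableT_comp mY measurable_fst) measurable_snd.
  by move=> /(_ measurableT [set true] I).
have F0 x : (0 <= F x)%E by rewrite mule_ge0.
transitivity (\int[P]_w F (w, H0 w))%E; first by [].
rewrite (@independent_integral _ T R P (past n) (@past_measurable n) _ (measurableTypeR R) H0 nu mH0 (@given_fading_indep n) F mF F0).
transitivity (\int[P]_w ((expR (- y))%:E * (g w * (\prod_(i < n) expR (- (b i w * H i w)))%:E)))%E.
  apply: eq_integral => w _; rewrite /F/=.
  have mYw : measurable [set h : measurableTypeR R | Y w < h].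
    rewrite (_ : [set _ | _] = `]Y w, +oo[%classic); first exact: measurable_itv.
    by apply/seteqP; split => h /=; rewrite in_itv/= andbT.
  rewrite (_ : (fun u => _) = fun u => (g w * (\1_[set h : measurableTypeR R | Y w < h] u)%:E)%E)//.
  rewrite ge0_integralZl//; last exact/measurable_EFinP/measurable_indic.
  rewrite integral_indic//= setIT [X in (_ * X)%E]exponential_tail//.
  rewrite muleCA -EFinM; congr (_ * _%:E)%E.
  rewrite /Y opprD expRD -sumrN expR_sum.
  by congr (_ * _); apply: eq_bigr.
rewrite ge0_integralZl_EFin//.
- by rewrite integral_fading.
- by move=> w _; rewrite mule_ge0// lee_fin prodr_ge0// => i _; exact: expR_ge0.
- apply: emeasurable_funM.
    exact: (measurableT_comp mg (measurable_g_sigma Gm)).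
  apply/measurable_EFinP; apply: measurable_prod => /= i _.
  apply: (measurableT_comp (@measurable_expR R)).
  apply: (measurableT_comp (@oppr_measurable R setT)); apply: measurable_funM.
    exact: (measurableT_comp (mb i) (measurable_g_sigma Gm)).
  exact: mH.
Qed.

End fading.

(** * Averaging over the types of the stations *)

(** [bool] stands in for [ltype] as a finite type, so that sums over all assignments of types make
    sense. *)
Definition ltype_of_bool (b : bool) : ltype := if b then LoS else NLoS.

Definition is_LoS (v : ltype) : bool := if v is LoS then true else false.

Lemma is_LoSK : cancel is_LoS ltype_of_bool. Proof. by case. Qed.

Section first_order_types.
Context (R : realType) (lambda beta : R) (B : segment_process R) (r : R) (N : bs_network R).
Hypothesis law : first_order_law lambda beta B r N.
Context (s : ltype).
Local Notation P := (bs_prob N).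
Local Notation T := (bs_space N).
Local Notation X := (other_pos N).
Let D : set T := [set w | given_type N w = s].

Definition type_prob (v : ltype) (z : plane R) : R :=
  p_joint B s v r (enorm z) (angle (given_pos N) z) / p_type beta s r.

Hypothesis ps_gt0 : 0 < p_type beta s r.
Hypothesis measurable_type_prob : forall v, measurable_fun setT (type_prob v).

Lemma p_joint_ge0 v t theta : 0 <= p_joint B s v r t theta.
Proof. exact: fine_ge0. Qed.

Lemma type_prob_ge0 v z : 0 <= type_prob v z.
Proof. by rewrite divr_ge0 ?p_joint_ge0// ltW. Qed.

Let mD : measurable D. Proof. exact: (fo_meas_given_type law). Qed.

Let gen_measurable : gen_events X `<=` measurable.
Proof.
move=> _ [i [A [mA ->]]]; rewrite -[X in measurable X]setTI.
exact: (fo_meas_pos law).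
Qed.

Let measurable_X_gen i :
  measurable_fun setT (X i : g_sigma_algebraType (gen_events X) -> plane R).
Proof.
move=> _ A mA; rewrite setTI; apply: sub_sigma_algebra.
by exists i, A.
Qed.

Let ext n (f : {ffun 'I_n -> bool}) (i : nat) : ltype :=
  ltype_of_bool (if insub i is Some j then f j else true).

Let extE n (f : {ffun 'I_n -> bool}) (i : 'I_n) : ext f i = ltype_of_bool (f i).
Proof. by rewrite /ext valK. Qed.

Let types n (v : nat -> ltype) : set T :=
  [set w | forall i, (i < n)%N -> other_type N i w = v i].

Let measurable_types n v : measurable (types n v).
Proof.
rewrite (_ : types n v = \bigcap_(i in `I_n) [set w | other_type N i w = v i]).
  by apply: fin_bigcap_measurable => // i _; exact: (fo_meas_type law).
by apply/seteqP; split.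
Qed.

Let prod_indic n (f : {ffun 'I_n -> bool}) w :
  \prod_(i < n) (\1_[set w | other_type N i w = ltype_of_bool (f i)] w : R) =
  \1_(types n (ext f)) w.
Proof.
rewrite [RHS]indicE; have [wf|wf] := boolP (w \in types n (ext f)).
  rewrite big1// => i _; rewrite indicE mem_set//= -extE.
  exact: (set_mem wf _ (ltn_ord i)).
apply/eqP/prodf_eq0; apply: contrapT => nex.
move/negP: wf; apply; apply/mem_set => i ilt; apply: contrapT => neq.
apply: nex; exists (Ordinal ilt) => //; rewrite indicE memNset//=.
by rewrite -(extE f (Ordinal ilt)).
Qed.

(** The first-order law says that the product of the [type_prob] is the density of a prescribed
    assignment of types relative to the positions. *)
Let one_type (n : nat) (v : nat -> ltype) (phi : nat -> plane R -> R) :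
  (forall i, measurable_fun setT (phi i)) -> (forall i z, 0 <= phi i z) ->
  (\int[P]_(w in D `&` types n v) (\prod_(i < n) phi i (X i w))%:E =
   \int[P]_(w in D) (\prod_(i < n) (phi i (X i w) * type_prob (v i) (X i w)))%:E)%E.
Proof.
move=> mphi phi0.
pose q w : R := \1_D w * \prod_(i < n) type_prob (v i) (X i w).
have mq : measurable_fun setT q.
  apply: measurable_funM => //; apply: measurable_prod => /= i _.
  exact: (measurableT_comp (measurable_type_prob (v i)) (fo_meas_pos law i)).
have q0 w : 0 <= q w.
  by rewrite mulr_ge0// prodr_ge0// => i _; exact: type_prob_ge0.
have mDV : measurable (D `&` types n v) by exact: measurableI.
have dens E : <<s gen_events X >> E ->
    P (E `&` (D `&` types n v)) = (\int[P]_(w in E) (q w)%:E)%E.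
  move=> GE; rewrite setIA (fo_other_type law)// integral_mkcond [RHS]integral_mkcond.
  apply: eq_integral => w _; rewrite !patchE in_setI /q indicE.
  by case: (w \in E); case: (w \in D) => //=; rewrite ?mul1r ?mul0r.
have mf : measurable_fun setT
    ((fun w => (\prod_(i < n) phi i (X i w))%:E) : g_sigma_algebraType (gen_events X) -> \bar R).
  apply/measurable_EFinP; apply: measurable_prod => /= i _.
  exact: (measurableT_comp (mphi i) (measurable_X_gen i)).
rewrite (density_integral gen_measurable mDV mq q0 dens mf); last first.
  by move=> w; rewrite lee_fin prodr_ge0.
rewrite [RHS]integral_mkcond; apply: eq_integral => w _.
rewrite patchE /q indicE -EFinM.
by case: (w \in D); rewrite ?mul1r ?mul0r ?mulr0// -big_split.
Qed.

(** Split over the assignments of types to the first [n] stations, integrate each one with its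
    density, and recombine: distributivity is used once in each direction. *)
Lemma type_average (n : nat) (phi : ltype -> plane R -> R) :
  (forall v, measurable_fun setT (phi v)) -> (forall v z, 0 <= phi v z) ->
  (\int[P]_(w in D) (\prod_(i < n) phi (other_type N i w) (X i w))%:E =
   \int[P]_(w in D) (\prod_(i < n) (type_prob LoS (X i w) * phi LoS (X i w) +
                              type_prob NLoS (X i w) * phi NLoS (X i w)))%:E)%E.
Proof.
move=> mphi phi0.
have mphiX v i : measurable_fun setT (fun w => phi v (X i w)).
  exact: (measurableT_comp (mphi v) (fo_meas_pos law i)).
have mqX v i : measurable_fun setT (fun w => type_prob v (X i w)).
  exact: (measurableT_comp (measurable_type_prob v) (fo_meas_pos law i)).
transitivity (\sum_(f : {ffun 'I_n -> bool})
   \int[P]_(w in D) (\1_(types n (ext f)) w * \prod_(i < n) phi (ext f i) (X i w))%:E)%E.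
  rewrite -ge0_integral_sum//; last 2 first.
  - move=> f; apply: measurable_funTS; apply/measurable_EFinP; apply: measurable_funM => //.
    by apply: measurable_prod => /= i _.
  - by move=> f w _; rewrite lee_fin mulr_ge0// prodr_ge0.
  apply: eq_integral => w _; rewrite sumEFin; congr EFin.
  transitivity (\prod_(i < n) \sum_(b : bool)
      (\1_[set w | other_type N i w = ltype_of_bool b] w * phi (ltype_of_bool b) (X i w))).
    apply: eq_bigr => i _; rewrite (bigD1 (is_LoS (other_type N i w)))//= is_LoSK.
    rewrite indicE mem_set// mul1r big1 ?addr0// => b bt.
    rewrite indicE memNset ?mul0r//= => tb; move/eqP: bt; apply.
    by rewrite tb; case: b {tb}.
  rewrite bigA_distr_bigA; apply: eq_bigr => f _; rewrite big_split/= prod_indic.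
  by congr (_ * _); apply: eq_bigr => i _; rewrite extE.
transitivity (\sum_(f : {ffun 'I_n -> bool}) \int[P]_(w in D)
   (\prod_(i < n) (phi (ext f i) (X i w) * type_prob (ext f i) (X i w)))%:E)%E.
  apply: eq_bigr => f _; rewrite -(@one_type n (ext f) (fun i => phi (ext f i)))//.
  rewrite integral_mkcond [RHS]integral_mkcond; apply: eq_integral => w _.
  rewrite !patchE in_setI indicE.
  by case: (w \in D); case: (w \in types n _) => //=; rewrite ?mul1r ?mul0r.
rewrite -ge0_integral_sum//; last 2 first.
- move=> f; apply: measurable_funTS; apply/measurable_EFinP.
  by apply: measurable_prod => /= i _; exact: measurable_funM.
- by move=> f w _; rewrite lee_fin prodr_ge0// => i _; rewrite mulr_ge0 ?type_prob_ge0.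
apply: eq_integral => w _; rewrite sumEFin; congr EFin.
transitivity (\prod_(i < n) \sum_(b : bool)
   (phi (ltype_of_bool b) (X i w) * type_prob (ltype_of_bool b) (X i w))).
  rewrite bigA_distr_bigA; apply: eq_bigr => f _.
  by apply: eq_bigr => i _; rewrite extE.
by apply: eq_bigr => i _; rewrite big_bool/= [X in X + _]mulrC [X in _ + X]mulrC.
Qed.

Hypothesis measurable_has_type_sec : forall v x, measurable [set w | has_type B v x w].

(* The first-order law forces the joint type probabilities of the Boolean model
   to have the marginal [p_type]: the two sides differ by a constant factor,
   which must be 1 since the types of one other base station exhaust the event
   that the given one is of type [s]. *)
Lemma type_prob_sum z : type_prob LoS z + type_prob NLoS z = 1.
Proof.
pose k := fine (sp_prob B [set w | has_type B s (polar r 0) w]) / p_type beta s r.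
have sumE x : type_prob LoS x + type_prob NLoS x = k.
  rewrite /type_prob -mulrDl /p_joint -fineD ?fin_num_measure//; last 2 first.
  - exact: (measurableI _ _ (measurable_has_type_sec s _) (measurable_has_type_sec LoS _)).
  - exact: (measurableI _ _ (measurable_has_type_sec s _) (measurable_has_type_sec NLoS _)).
  congr (fine _ / _).
  rewrite [RHS](measureDI (sp_prob B) _ (measurable_has_type_sec LoS
    (polar (enorm x) (angle (given_pos N) x))))//.
  by rewrite addeC.
rewrite sumE.
have := @type_average 1 (fun _ _ => 1) (fun=> measurable_cst _) (fun _ _ => ler01).
under eq_integral do rewrite big1//.
under [in X in _ = X -> _]eq_integral do rewrite big_ord1 !mulr1 sumE.
rewrite !integral_cst//= [P D](fo_given_type law) -!EFinM => -[].
rewrite mul1r => /esym/eqP; rewrite -subr_eq0 -{2}[p_type _ _ _]mul1r -mulrBl mulf_eq0.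
by rewrite [p_type _ _ _ == 0]gt_eqF// orbF subr_eq0 => /eqP.
Qed.

End first_order_types.

(** The generating functional requires a genuine probability measure, while the Poisson hypothesis
    is stated with the set function [cond_prob]. *)
Lemma conditional_probability d (T : measurableType d) (R : realType)
    (P : probability T R) (D : set T) : measurable D -> (0 < P D)%E ->
  exists Pc : probability T R,
    (forall A, measurable A -> fine (Pc A) = cond_prob P D A) /\
    (forall f : T -> \bar R, measurable_fun setT f -> (forall w, 0 <= f w)%E ->
      \int[P]_(w in D) f w = (fine (P D))%:E * \int[Pc]_w f w)%E.
Proof.
move=> mD PD0.
have PDfin : P D \is a fin_num by exact: fin_num_measure.
have PD_gt0 : 0 < fine (P D) by rewrite fine_gt0// PD0 ltey_eq PDfin.
pose q w : R := (fine (P D))^-1 * \1_D w.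
have mq : measurable_fun setT q by exact: measurable_funM.
have q0 w : 0 <= q w by rewrite mulr_ge0// invr_ge0 ltW.
pose Pc := mnormalize (mrestr P mD) P.
have PcE A : measurable A -> Pc A = (P (A `&` D) * ((fine (P D))^-1)%:E)%E.
  move=> mA; rewrite /Pc /mnormalize /= /mrestr setTI ifF//.
  by apply/negbTE; rewrite negb_or gt_eqF//=; move: PDfin; rewrite fin_numE => /andP[].
exists (mnormalize (mrestr P mD) P); split => [A mA|f mf f0].
  rewrite /cond_prob [X in fine X](PcE _ mA) fineM// fin_num_measure//.
  exact: measurableI.
transitivity ((fine (P D))%:E * \int[density_measure P q]_w f w)%E; last first.
  congr (_ * _)%E; apply: eq_measure_integral => A mA _.
  rewrite [RHS]PcE// muleC /= /density_measure /q.
  under eq_integral do rewrite EFinM.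
  rewrite ge0_integralZl_EFin//.
  - by rewrite integral_indic// setIC.
  - by apply/measurable_EFinP; exact: measurable_funTS.
  - by rewrite invr_ge0 ltW.
rewrite (integral_density_measure P mq q0)// -ge0_integralZl_EFin//.
- rewrite [LHS]integral_mkcond; apply: eq_integral => w _.
  rewrite patchE /q indicE muleCA -EFinM mulrA divff ?gt_eqF// mul1r.
  by case: ifP => _; rewrite ?mule1 ?mule0.
- by move=> w _; rewrite mule_ge0// lee_fin.
- by apply: emeasurable_funM => //; exact/measurable_EFinP.
- exact: ltW.
Qed.

Lemma eq_is_PPP d (T : measurableType d) (R : realType) (Pr Pr' : set T -> R)
    (lambda : R) (X : nat -> T -> plane R) :
  (forall i, measurable_fun setT (X i)) ->
  (forall A, measurable A -> Pr A = Pr' A) ->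
  is_PPP Pr lambda X -> is_PPP Pr' lambda X.
Proof.
move=> mX PrE [H1 H2].
have mlevel A k : measurable A -> measurable [set w | npoints X A w = k%:R%:E].
  move=> mA; rewrite (_ : [set _ | _] = npoints X A @^-1` [set k%:R%:E])//.
  by rewrite -[X in measurable X]setTI; exact: measurable_npoints.
split=> [A k mA Afin|n A k mA tA].
  by rewrite -PrE; [exact: H1|exact: mlevel].
rewrite -PrE.
  rewrite H2//; apply: eq_bigr => i _; rewrite PrE//.
  by apply: mlevel; exact: (mA i (ltn_ord i)).1.
rewrite (_ : [set _ | _] = \bigcap_(i in `I_n) [set w | npoints X (A i) w = (k i)%:R%:E]).
  by apply: fin_bigcap_measurable => // i ilt; apply: mlevel; exact: (mA i ilt).1.
by apply/seteqP; split.
Qed.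

(** * Probability of serving with SINR above the threshold *)

Section path_loss.
Context (R : realType) (ell : ltype -> R -> R) (hell : is_path_loss ell).

(** Clamping at 0 gives a function monotone on the whole line; [ell] is constrained only on
    nonnegative distances. *)
Lemma measurable_path_loss v :
  measurable_fun setT (fun t : R => ell v (Num.max 0 t)).
Proof.
apply: nonincreasing_measurable => // x y xy.
apply: (pl_nonincreasing hell); first by rewrite le_max lexx.
by rewrite ge_max !le_max lexx xy orbT.
Qed.

Lemma measurable_path_loss_enorm v : measurable_fun setT (fun z : plane R => ell v (enorm z)).
Proof.
rewrite (_ : (fun z => _) = (fun t : R => ell v (Num.max 0 t)) \o @enorm R).
  exact: (measurableT_comp (measurable_path_loss v) (@measurable_enorm R)).
by apply/funext => z /=; rewrite max_r ?enorm_ge0.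
Qed.

Lemma measurable_exclusion (e : \bar R) : measurable [set z : plane R | (e < (enorm z)%:E)%E].
Proof.
case: e => [x| |].
- rewrite (_ : [set _ | _] = @enorm R @^-1` `]x, +oo[).
    by rewrite -[X in measurable X]setTI; apply: measurable_enorm.
  by apply/seteqP; split => z /=; rewrite in_itv/= lte_fin andbT.
- by rewrite (_ : [set _ | _] = set0)//; apply/seteqP; split.
- by rewrite (_ : [set _ | _] = setT)//; apply/seteqP; split => // z _ /=; rewrite ltNyr.
Qed.

End path_loss.

Section serving_coverage.
Context (R : realType) (lambda beta : R) (B : segment_process R) (r : R) (N : bs_network R).
Hypothesis law : first_order_law lambda beta B r N.
Context (s : ltype) (ell : ltype -> R -> R) (noise tau : R).
Hypotheses (hell : is_path_loss ell) (lambda_gt0 : 0 < lambda)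
  (noise_gt0 : 0 < noise) (tau_gt0 : 0 < tau).
Hypothesis ps_gt0 : 0 < p_type beta s r.
Hypothesis ell_gt0 : 0 < ell s r.
Local Notation q := (type_prob beta B r N s).
Hypothesis mq : forall v, measurable_fun setT (q v).
Hypothesis q_sum : forall z, q LoS z + q NLoS z = 1.
Local Notation P := (bs_prob N).
Local Notation T := (bs_space N).
Local Notation X := (other_pos N).
Local Notation GT := (g_sigma_algebraType (type_pos_events N)).
Let D : set T := [set w | given_type N w = s].
Let c := tau / ell s r.
Let kb v (z : plane R) : R := c * ell v (enorm z).
Let kg v (z : plane R) : R := \1_[set z : plane R | (excl ell v s r < (enorm z)%:E)%E] z.

Definition retention v (z : plane R) : R := kg v z * (1 + kb v z)^-1.
Definition mean_retention (z : plane R) : R :=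
  q LoS z * retention LoS z + q NLoS z * retention NLoS z.

Let mD : measurable D. Proof. exact: (fo_meas_given_type law). Qed.

Let c_gt0 : 0 < c. Proof. exact: divr_gt0. Qed.

Let kb_ge0 v z : 0 <= kb v z.
Proof. by rewrite mulr_ge0 ?(ltW c_gt0)// (pl_ge0 hell)// enorm_ge0. Qed.

Let measurable_kb v : measurable_fun setT (kb v).
Proof. by apply: measurable_funM => //; exact: measurable_path_loss_enorm. Qed.

Let measurable_kg v : measurable_fun setT (kg v).
Proof. by apply: measurable_indic; exact: measurable_exclusion. Qed.

Lemma retention01 v z : 0 <= retention v z <= 1.
Proof.
have kb1 : 1 <= 1 + kb v z by rewrite lerDl.
rewrite mulr_ge0 ?invr_ge0 ?(le_trans ler01 kb1)//= mulr_ile1//.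
- by rewrite invr_ge0 (le_trans ler01).
- by rewrite /kg indicE; case: (_ \in _).
- by rewrite invf_le1// (lt_le_trans ltr01).
Qed.

Lemma measurable_retention v : measurable_fun setT (retention v).
Proof.
apply: measurable_funM => //.
rewrite (_ : (fun z => _) = fun z => (1 + kb v z) `^ (-1)).
  apply: (measurableT_comp (@measurable_powR R (-1))); apply: measurable_funD => //.
by apply/funext => w; rewrite powR_inv1// addr_ge0.
Qed.

Lemma mean_retention01 z : 0 <= mean_retention z <= 1.
Proof.
have q0 v : 0 <= q v z by exact: type_prob_ge0.
have /andP[L0 L1] := retention01 LoS z; have /andP[N0 N1] := retention01 NLoS z.
apply/andP; split; first by rewrite /mean_retention addr_ge0// mulr_ge0.
apply: (@le_trans _ _ (q LoS z + q NLoS z)); last by rewrite q_sum.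
by apply: lerD; rewrite -[leRHS]mulr1 ler_wpM2l.
Qed.

Lemma measurable_mean_retention : measurable_fun setT mean_retention.
Proof.
by apply: measurable_funD; apply: measurable_funM => //; exact: measurable_retention.
Qed.

Let typepos_measurable : type_pos_events N `<=` measurable.
Proof.
move=> _ [[[i [A [mA ->]]]|[v ->]]|[i [v ->]]].
- by rewrite -[X in measurable X]setTI; exact: (fo_meas_pos law).
- exact: (fo_meas_given_type law).
- exact: (fo_meas_type law).
Qed.

(** [ltype] carries no sigma-algebra, so the type is split off by indicators. *)
Let measurable_typepos (k : ltype -> plane R -> R) i : (forall v, measurable_fun setT (k v)) ->
  measurable_fun setT ((fun w => k (other_type N i w) (X i w)) : GT -> R).
Proof.
move=> mk.
have mX : measurable_fun setT (X i : GT -> plane R).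
  move=> _ A mA; rewrite setTI; apply: sub_sigma_algebra; left; left.
  by exists i, A.
have mt v : measurable ([set w | other_type N i w = v] : set GT).
  by apply: sub_sigma_algebra; right; exists i, v.
rewrite (_ : (fun w => _) = fun w : GT =>
   \1_([set w | other_type N i w = LoS] : set GT) w * k LoS (X i w) +
   \1_([set w | other_type N i w = NLoS] : set GT) w * k NLoS (X i w)).
  apply: measurable_funD; apply: measurable_funM.
  - exact: measurable_indic.
  - exact: (measurableT_comp (mk LoS) mX).
  - exact: measurable_indic.
  - exact: (measurableT_comp (mk NLoS) mX).
apply/funext => w; rewrite !indicE; case E : (other_type N i w).
  by rewrite mem_set// memNset ?mul1r ?mul0r ?addr0//= E.
by rewrite memNset/= ?E// mem_set//= mul1r mul0r add0r.
Qed.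

Let measurable_typepos_D : measurable (D : set GT).
Proof. by apply: sub_sigma_algebra; left; right; exists s. Qed.

(** The covered event seen by the first [n] stations, with the noise raised by [eps]. The SINR
    inequality is multiplied out by [c = tau / ell s r], which makes the threshold linear in the
    fadings. *)
Let A (eps : R) n : set T := [set w | [/\ given_type N w = s,
  forall i, (i < n)%N ->
    (excl ell (other_type N i w) s r < (enorm (X i w))%:E)%E &
  c * (noise + eps) + \sum_(i < n) kb (other_type N i w) (X i w) * other_fading N i w
    < given_fading N w]].

Let guard n w : R := \1_D w * \prod_(i < n) kg (other_type N i w) (X i w).

Let A_indic eps n w : \1_(A eps n) w = guard n w *
  \1_[set w | c * (noise + eps) + \sum_(i < n) kb (other_type N i w) (X i w) * other_fading N i w
    < given_fading N w] w.
Proof.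
rewrite /guard; have [Dw|Dw] := boolP (w \in D); last first.
  rewrite [\1_D w]indicE (negbTE Dw) !mul0r indicE memNset// => -[Dw' _ _].
  by move/negP: Dw; apply; apply/mem_set.
have [gw|gw] := pselect (forall i, (i < n)%N ->
    (excl ell (other_type N i w) s r < (enorm (X i w))%:E)%E); last first.
  rewrite indicE memNset; last by move=> [_ + _].
  rewrite (_ : \prod_(i < n) _ = 0) ?mulr0 ?mul0r//; apply/eqP/prodf_eq0.
  apply: contrapT => nex; apply: gw => i ilt; apply: contrapT => neq.
  by apply: nex; exists (Ordinal ilt) => //; rewrite /kg indicE memNset.
rewrite [\1_D w]indicE Dw mul1r big1 ?mul1r; last first.
  by move=> i _; rewrite /kg indicE mem_set//; exact: gw.
rewrite !indicE; congr (_%:R); congr nat_of_bool; apply/idP/idP => /set_mem H; apply/mem_set.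
  by case: H.
by split => //; exact: set_mem Dw.
Qed.

Let measurable_guard n : measurable_fun setT (guard n : GT -> R).
Proof.
apply: measurable_funM; first exact: measurable_indic.
by apply: measurable_prod => /= i _; exact: measurable_typepos.
Qed.

Let to_T d' (S : measurableType d') (f : T -> S) :
  measurable_fun setT (f : GT -> S) -> measurable_fun setT f.
Proof. by move=> mf; exact: (measurableT_comp mf (measurable_g_sigma typepos_measurable)). Qed.

Let measurable_received y n : measurable
  [set w | y + \sum_(i < n) kb (other_type N i w) (X i w) * other_fading N i w
    < given_fading N w].
Proof.
have mS : measurable_fun setT (fun w => y + \sum_(i < n)
    kb (other_type N i w) (X i w) * other_fading N i w : R).
  apply: measurable_funD => //; apply: measurable_sum => i; apply: measurable_funM.
    by apply: to_T; exact: measurable_typepos.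
  exact: (fo_meas_fading law).
have := measurable_fun_ltr mS (fo_meas_given_fading law).
move=> /(_ measurableT [set true] I); rewrite setTI.
by congr measurable.
Qed.

Let measurable_A eps n : measurable (A eps n).
Proof.
rewrite (_ : A eps n = (\1_(A eps n) : T -> R) @^-1` [set 1]); last first.
  apply/seteqP; split => w /=; rewrite indicE; first by move=> Aw; rewrite mem_set.
  by case: (boolP (w \in A eps n)) => [/set_mem//|_ /eqP]; rewrite eq_sym oner_eq0.
rewrite -[X in measurable X]setTI.
suff mf : measurable_fun setT (\1_(A eps n) : T -> R) by exact: mf.
have -> : \1_(A eps n) = (fun w => guard n w * \1_[set w | c * (noise + eps) +
    \sum_(i < n) kb (other_type N i w) (X i w) * other_fading N i w
      < given_fading N w] w) by apply/funext => w; exact: A_indic.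
apply: measurable_funM; first by apply: to_T; exact: measurable_guard.
by apply: measurable_indic; exact: measurable_received.
Qed.

Let prob_A eps n : 0 <= eps ->
  (P (A eps n) = (expR (- (c * (noise + eps))))%:E *
     \int[P]_(w in D) (\prod_(i < n) mean_retention (X i w))%:E)%E.
Proof.
move=> eps0.
have y0 : 0 <= c * (noise + eps) by rewrite mulr_ge0 ?(ltW c_gt0)// addr_ge0// ltW.
rewrite -[A eps n]setIT -integral_indic//.
under eq_integral do rewrite A_indic EFinM.
have := @integral_given_fading _ T R P (type_pos_events N) typepos_measurable
  (given_fading N) (other_fading N) (fo_meas_given_fading law) (fo_meas_fading law)
  (fo_fading_ge0 law) (fo_fading law) n (c * (noise + eps)) (fun w => (guard n w)%:E)
  (fun i w => kb (other_type N i w) (X i w)) y0.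
move=> ->; last 4 first.
- by apply/measurable_EFinP; exact: measurable_guard.
- by move=> w; rewrite lee_fin mulr_ge0// prodr_ge0.
- by move=> i; exact: measurable_typepos.
- by move=> i w; exact: kb_ge0.
congr (_ * _)%E.
rewrite -(@type_average _ _ _ _ _ _ law s ps_gt0 mq n retention); last 2 first.
- exact: measurable_retention.
- by move=> v z; have /andP[] := retention01 v z.
rewrite [RHS]integral_mkcond; apply: eq_integral => w _.
rewrite patchE /guard indicE -EFinM.
case: (w \in D); rewrite ?mul0r// mul1r -big_split/=.
by congr EFin; apply: eq_bigr.
Qed.

Let K : \bar R := ((p_type beta s r)%:E *
  expeR (- (lambda%:E * \int[@area R]_z (1 - mean_retention z)%:E)))%E.

Let prob_A_cvg eps : 0 <= eps ->
  P (A eps n) @[n --> \oo] --> ((expR (- (c * (noise + eps))))%:E * K)%E.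
Proof.
move=> eps0; under eq_fun do rewrite prob_A//.
apply: cvgeZl => //.
have PD : P D = (p_type beta s r)%:E by exact: (fo_given_type law).
have [|Pc [PcE intPc]] := conditional_probability (P := P) mD; first by rewrite PD lte_fin.
have XPP : is_PPP (fun E => fine (Pc E)) lambda X.
  apply: (eq_is_PPP (fo_meas_pos law) _ (fo_other_pos law s)) => E mE.
  by rewrite PcE.
have -> : (fun n => \int[P]_(w in D) (\prod_(i < n) mean_retention (X i w))%:E)%E =
    (fun n => (p_type beta s r)%:E *
       \int[Pc]_w (\prod_(i < n) mean_retention (X i w))%:E)%E.
  apply/funext => n; rewrite intPc ?PD//.
  - apply/measurable_EFinP; apply: measurable_prod => /= i _.
    exact: (measurableT_comp measurable_mean_retention (fo_meas_pos law i)).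
  - by move=> w; rewrite lee_fin prodr_ge0// => i _; have /andP[] := mean_retention01 (X i w).
apply: cvgeZl => //.
exact: (generating_functional lambda_gt0 (fo_meas_pos law) XPP measurable_mean_retention mean_retention01).
Qed.

Let A_decreasing eps : {homo A eps : n m / (n <= m)%N >-> (m <= n)%O}.
Proof.
apply/nonincreasing_seqP => n; apply/subsetPset => w [Dw gw Sw]; split => //.
  by move=> i ilt; apply: gw; exact: ltnW.
apply: le_lt_trans Sw; rewrite big_ord_recr/= lerD2l lerDl.
by rewrite mulr_ge0 ?kb_ge0 ?(fo_fading_ge0 law).
Qed.

Let cap_A_increasing : {homo (fun m => \bigcap_n A (m.+1%:R^-1) n) : n m / (n <= m)%N >-> (n <= m)%O}.
Proof.
move=> n m nm; apply/subsetPset => w Aw k _; have [Dw gw Sw] := Aw k I; split => //.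
apply: le_lt_trans Sw; rewrite lerD2r ler_wpM2l ?(ltW c_gt0)// lerD2l.
by rewrite lef_pV2 ?posrE// ler_nat.
Qed.

Let received n w : R :=
  \sum_(i < n) other_fading N i w * ell (other_type N i w) (enorm (X i w)).

Let receivedE n w :
  \sum_(i < n) kb (other_type N i w) (X i w) * other_fading N i w = c * received n w.
Proof. by rewrite mulr_sumr; apply: eq_bigr => i _; rewrite /kb -mulrA [ell _ _ * _]mulrC. Qed.

Let term_ge0 i w : 0 <= other_fading N i w * ell (other_type N i w) (enorm (X i w)).
Proof. by rewrite mulr_ge0 ?(fo_fading_ge0 law)// (pl_ge0 hell)// enorm_ge0. Qed.

Let received_sum n w : ((received n w)%:E = \sum_(0 <= i < n)
  (other_fading N i w * ell (other_type N i w) (enorm (X i w)))%:E)%E.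
Proof. by rewrite big_mkord sumEFin. Qed.

Let interference_leP (a : R) w :
  (interference ell N w <= a%:E)%E <-> forall n, received n w <= a.
Proof.
split=> [Ia n|ra].
  rewrite -lee_fin received_sum; apply: le_trans Ia.
  by apply: nneseries_lim_ge => i _ _; rewrite lee_fin.
apply: lime_le; first by apply: is_cvg_nneseries => i _ _; rewrite lee_fin.
by apply: nearW => n; rewrite -received_sum lee_fin.
Qed.

Let interference_ge0 w : (0 <= interference ell N w)%E.
Proof. by apply: nneseries_ge0 => i _ _; rewrite lee_fin. Qed.

Let SINR_gt (b : R) w : given_type N w = s -> interference ell N w = b%:E ->
  (tau%:E < SINR ell noise N w)%E = (c * (noise + b) < given_fading N w).
Proof.
move=> ts Ib; have b0 : 0 <= b by rewrite -lee_fin -Ib.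
have nb : 0 < noise + b by rewrite ltr_wpDr.
rewrite /SINR ts (fo_given_pos law) Ib -EFinD inver gt_eqF// -EFinM lte_fin.
by rewrite ltr_pdivlMr// /c mulrAC ltr_pdivrMr.
Qed.

(** A strict inequality leaves room for some [m.+1%:R^-1], and then holds for all partial sums.
    Conversely, strict bounds on the partial sums give only a weak bound on the interference, and
    the margin restores strictness. *)
Lemma covered_eventE :
  [set w | [/\ given_type N w = s, serving ell N w & (tau%:E < SINR ell noise N w)%E]] =
  \bigcup_m \bigcap_n A (m.+1%:R^-1) n.
Proof.
apply/seteqP; split => w.
  move=> [ts sv]; case E : (interference ell N w) => [b| |]; last 2 first.
  (* Infinite interference makes the SINR equal to 0, which is below [tau]. *)
  - by rewrite /SINR E addey// invey mule0 lte_fin ltNge ltW.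
  - by have := interference_ge0 w; rewrite E.
  rewrite (SINR_gt ts E) mulrC -ltr_pdivlMr// => /ltr_add_invr[m hm].
  exists m => // n _; split => //.
    by move=> i _; have := sv i; rewrite ts (fo_given_pos law).
  rewrite receivedE -mulrDr mulrC -ltr_pdivlMr//; apply: le_lt_trans hm.
  rewrite addrAC lerD2r lerD2l; move: n; apply/interference_leP; by rewrite E.
move=> [m _ Aw]; have [ts _ _] := Aw 0%N I.
have Ile : (interference ell N w <= (given_fading N w / c - (noise + m.+1%:R^-1))%:E)%E.
  apply/interference_leP => n; have [_ _] := Aw n I.
  by rewrite receivedE -mulrDr mulrC -ltr_pdivlMr// lerBrDl => /ltW.
split => //.
  by move=> i; have [_ gw _] := Aw i.+1 I; rewrite ts (fo_given_pos law); exact: gw.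
case E : (interference ell N w) => [b| |].
- rewrite (SINR_gt ts E) mulrC -ltr_pdivlMr//.
  move: Ile; rewrite E lee_fin lerBrDl; apply: lt_le_trans.
  by rewrite addrAC ltrDl invr_gt0.
- by move: Ile; rewrite E.
- by have := interference_ge0 w; rewrite E.
Qed.

(** Continuity of [P] from above in the number of stations, then from below in [m], where only the
    noise factor varies. *)
Lemma serving_coverage_probability :
  P [set w | [/\ given_type N w = s, serving ell N w & (tau%:E < SINR ell noise N w)%E]] =
  ((expR (- (tau * noise / ell s r)))%:E * K)%E.
Proof.
have mcap m : measurable (\bigcap_n A (m.+1%:R^-1) n) by exact: bigcapT_measurable.
rewrite covered_eventE.
have up := @nondecreasing_cvg_mu _ _ _ P (fun m => \bigcap_n A (m.+1%:R^-1) n) mcap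
  (bigcupT_measurable _ mcap) cap_A_increasing.
rewrite -(cvg_lim _ up)//; apply/cvg_lim => //.
have capE m : P (\bigcap_n A (m.+1%:R^-1) n) = ((expR (- (c * (noise + m.+1%:R^-1))))%:E * K)%E.
  have down := @nonincreasing_cvg_mu _ _ _ P (A (m.+1%:R^-1)) _ (measurable_A _) (mcap m) (@A_decreasing _).
  rewrite -(cvg_lim _ (down _))//; last by rewrite ltey_eq fin_num_measure.
  by apply/cvg_lim => //; exact: prob_A_cvg.
have -> : P \o (fun m => \bigcap_n A (m.+1%:R^-1) n) =
  (fun m => (expR (- (c * (noise + m.+1%:R^-1))))%:E * K)%E by apply/funext => m; exact: capE.
(* Finiteness of [K], a probability times the exponential of a nonpositive quantity, lets the limit
   pass through the product. *)
have Kfin : K \is a fin_num.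
  rewrite /K fin_numM// ge0_fin_numE ?expeR_ge0//; apply: (@le_lt_trans _ _ 1%E); last exact: ltry.
  rewrite -expeR0 lee_expeR leeNl oppe0 mule_ge0// ?lee_fin ?(ltW lambda_gt0)//.
  apply: integral_ge0 => z _; rewrite lee_fin subr_ge0.
  by have /andP[] := mean_retention01 z.
apply: cvgeZr => //.
apply: cvg_EFin; first exact: nearW.
have -> : tau * noise / ell s r = c * (noise + 0) by rewrite addr0 /c; ring.
apply: continuous_cvg; first exact: continuous_expR.
apply: cvgN; apply: cvgMr; apply: cvgD; first exact: cvg_cst.
exact: cvg_harmonic.
Qed.

End serving_coverage.

(** * The exponent in polar coordinates *)

Section ge0_scaling.
Context d (T : measurableType d) (R : realType) (mu : {measure set T -> \bar R}).

Let ge0_integral_scale_le (k : R) (f : T -> \bar R) : 0 < k -> (forall x, 0 <= f x)%E ->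
  (\int[mu]_x (k%:E * f x) <= k%:E * \int[mu]_x f x)%E.
Proof.
move=> k0 f0; have kf0 x : (0 <= k%:E * f x)%E by rewrite mule_ge0// lee_fin ltW.
rewrite [leLHS]ge0_integralTE//; apply: ub_ereal_sup => _ [h /= hkf <-].
have kV0 : 0 <= k^-1 by rewrite invr_ge0 ltW.
rewrite -lee_pdivrMl// -sintegralrM ge0_integralTE//; apply: ereal_sup_ubound.
exists (scale_nnsfun h kV0) => //= x; rewrite EFinM.
by rewrite lee_pdivrMl.
Qed.

Lemma ge0_integral_pscale (D : set T) (k : R) (f : T -> \bar R) : 0 < k ->
  (forall x, D x -> 0 <= f x)%E ->
  (\int[mu]_(x in D) (k%:E * f x) = k%:E * \int[mu]_(x in D) f x)%E.
Proof.
move=> k0 f0; rewrite integral_mkcond [in RHS]integral_mkcond.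
have -> : (fun x => k%:E * f x)%E \_ D = (fun x => k%:E * (f \_ D) x)%E.
  by apply/funext => x; rewrite !patchE; case: ifP; rewrite ?mule0.
have fD0 x : (0 <= (f \_ D) x)%E by exact: erestrict_ge0.
apply/eqP; rewrite eq_le ge0_integral_scale_le//=.
have kV0 : 0 < k^-1 by rewrite invr_gt0.
have := @ge0_integral_scale_le _ (fun x => k%:E * (f \_ D) x)%E kV0.
under [X in (_ -> X <= _)%E -> _]eq_integral do rewrite muleA -EFinM mulVf ?gt_eqF// mul1e.
rewrite lee_pdivlMl//; apply => x; rewrite mule_ge0// lee_fin; exact: ltW.
Qed.

End ge0_scaling.

Lemma excl_ge0 (R : realType) (ell : ltype -> R -> R) v s (r : R) : 0 <= r ->
  (0 <= excl ell v s r)%E.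
Proof.
move=> r0; rewrite /excl; case: v; case: s; rewrite ?lee_fin//;
  by apply/ereal_infP => _ [y [y0 _] <-]; rewrite lee_fin.
Qed.

Lemma sir_factorE (R : realType) (tau a b : R) : 0 < tau -> 0 < a -> 0 <= b ->
  sir_factor tau a b = 1 - (1 + tau / a * b)^-1.
Proof.
move=> t0 a0; rewrite le_eqVlt => /orP[/eqP <-|b0].
  by rewrite /sir_factor eqxx mulr0 addr0 invr1 subrr.
rewrite /sir_factor gt_eqF// div1r.
have h1 : 0 < a + tau * b by rewrite addr_gt0// mulr_gt0.
by field; rewrite !gt_eqF.
Qed.

Section exponent.
Context (R : realType) (lambda beta tau r : R) (B : segment_process R) (N : bs_network R).
Context (s : ltype) (ell : ltype -> R -> R).
Hypotheses (hell : is_path_loss ell) (lambda_gt0 : 0 < lambda) (tau_gt0 : 0 < tau)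
  (r_ge0 : 0 <= r) (ps_gt0 : 0 < p_type beta s r) (ell_gt0 : 0 < ell s r).
Hypothesis measurable_prob : forall v, measurable_fun setT
  (fun z : plane R => fine (sp_prob B [set w | has_type B s (polar r 0) w /\ has_type B v z w])).
Local Notation q := (type_prob beta B r N s).
Local Notation mu := (@lebesgue_measure R).
Local Notation c := (tau / ell s r).

(** The type probability in the frame where the given station lies on the first axis. *)
Let qh v (z : plane R) : R :=
  fine (sp_prob B [set w | has_type B s (polar r 0) w /\ has_type B v z w]) / p_type beta s r.

Let qhE v z : q v z = qh v (rotate (- polar_angle (given_pos N)) z).
Proof. by rewrite /type_prob /p_joint polar_enorm_angle_rotate. Qed.

Let measurable_qh v : measurable_fun setT (qh v).
Proof. exact: measurable_funM. Qed.

Lemma measurable_type_prob v : measurable_fun setT (q v).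
Proof.
rewrite (_ : type_prob _ _ _ _ _ _ = qh v \o rotate (- polar_angle (given_pos N))).
  exact: (measurableT_comp (measurable_qh v) (measurable_rotate _)).
by apply/funext => z; exact: qhE.
Qed.

Let qh_ge0 v z : 0 <= qh v z. Proof. by rewrite divr_ge0 ?fine_ge0// ltW. Qed.

Let outside v (z : plane R) : R := \1_[set z : plane R | (excl ell v s r < (enorm z)%:E)%E] z.

Let sir v t : R := 1 - (1 + c * ell v (Num.max 0 t))^-1.

Let ell_max_ge0 v t : 0 <= ell v (Num.max 0 t).
Proof. by apply: (pl_ge0 hell); rewrite le_max lexx. Qed.

Let sir_ge0 v t : 0 <= sir v t.
Proof.
have h : 1 <= 1 + c * ell v (Num.max 0 t) by rewrite lerDl mulr_ge0// divr_ge0// ltW.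
by rewrite subr_ge0 invf_le1// (lt_le_trans ltr01).
Qed.

Let measurable_sir v : measurable_fun setT (sir v).
Proof.
apply: measurable_funB => //.
rewrite (_ : (fun t => _) = fun t => (1 + c * ell v (Num.max 0 t)) `^ (-1)).
  apply: (measurableT_comp (@measurable_powR R (-1))); apply: measurable_funD => //.
  by apply: measurable_funM => //; exact: measurable_path_loss.
by apply/funext => t; rewrite powR_inv1// addr_ge0// mulr_ge0// divr_ge0// ltW.
Qed.

(** With [o] the indicator of lying outside the exclusion radius, [1 - o / (1 + k) = o (1 - 1 / (1 +
    k)) + (1 - o)]: [interfering] and [excluded] are these two parts weighted by the type
    probability. *)
Let interfering v z := qh v z * (outside v z * sir v (enorm z)).
Let excluded v z := qh v z * (1 - outside v z).

Let measurable_outside v : measurable_fun setT (outside v).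
Proof. by apply: measurable_indic; exact: measurable_exclusion. Qed.

Let measurable_interfering v : measurable_fun setT (interfering v).
Proof.
apply: measurable_funM => //; apply: measurable_funM => //.
exact: (measurableT_comp (measurable_sir v) (@measurable_enorm R)).
Qed.

Let measurable_excluded v : measurable_fun setT (excluded v).
Proof. by apply: measurable_funM => //; exact: measurable_funB. Qed.

Let outside01 v z : 0 <= outside v z <= 1.
Proof. by rewrite /outside indicE; case: (_ \in _); rewrite lexx ler01. Qed.

Let interfering_ge0 v z : 0 <= interfering v z.
Proof. by apply: mulr_ge0 => //; apply: mulr_ge0. Qed.

Let excluded_ge0 v z : 0 <= excluded v z.
Proof. by rewrite mulr_ge0// subr_ge0; have /andP[] := outside01 v z. Qed.

Let polar_mean (f : plane R -> R) : \bar R :=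
  (\int[mu]_(theta in `[0%R, (2 * pi)%R]) \int[mu]_(t in `]0%R, +oo[)
     ((f (polar t theta))%:E * t%:E))%E.

Let mean_retention_exponent : (forall z, q LoS z + q NLoS z = 1) ->
  (\int[@area R]_z (1 - mean_retention beta B r N s ell tau z)%:E =
   (polar_mean (interfering LoS) + polar_mean (excluded LoS)) +
   (polar_mean (interfering NLoS) + polar_mean (excluded NLoS)))%E.
Proof.
move=> q1; pose Rot z := rotate (- polar_angle (given_pos N)) z.
transitivity (\int[@area R]_z
  ((interfering LoS (Rot z) + excluded LoS (Rot z)) +
   (interfering NLoS (Rot z) + excluded NLoS (Rot z)))%:E)%E.
  apply: eq_integral => z _; congr EFin.
  have retE v : q v z * retention r s ell tau v z =
      q v z - (interfering v (Rot z) + excluded v (Rot z)).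
    have outE : outside v (Rot z) = outside v z.
      rewrite /outside !indicE; congr (_%:R); congr nat_of_bool.
      by apply/idP/idP => /set_mem H; apply/mem_set; move: H; rewrite /= /Rot enorm_rotate.
    rewrite /interfering /excluded -!qhE outE /Rot enorm_rotate /sir max_r ?enorm_ge0//.
    by rewrite /retention -/(outside v z); ring.
  by rewrite /mean_retention !retE -(q1 z); ring.
have polE (f : plane R -> R) : measurable_fun setT f -> (forall z, 0 <= f z) ->
    (\int[@area R]_z (f (Rot z))%:E = polar_mean f)%E.
  move=> mf f0; rewrite (@integral_polar_rotate _ (EFin \o f))//.
  - exact: polar_angle_ge0_le.
  - exact/measurable_EFinP.
have mRot (f : plane R -> R) : measurable_fun setT f ->
    measurable_fun setT (fun z => (f (Rot z))%:E).
  by move=> mf; apply/measurable_EFinP; exact: (measurableT_comp mf (measurable_rotate _)).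
under eq_integral do rewrite !EFinD.
rewrite ge0_integralD//; last 4 first.
- by move=> z _; rewrite adde_ge0// lee_fin.
- by apply: emeasurable_funD; exact: mRot.
- by move=> z _; rewrite adde_ge0// lee_fin.
- by apply: emeasurable_funD; exact: mRot.
by rewrite !ge0_integralD ?polE//; (try exact: mRot); move=> z _; rewrite lee_fin.
Qed.

Let outside_polar v t theta : 0 <= t ->
  outside v (polar t theta) = ((excl ell v s r < t%:E)%E)%:R.
Proof.
move=> t0; rewrite /outside indicE; congr (_%:R); congr nat_of_bool.
by apply/idP/idP => [/set_mem/=|H]; [|apply/mem_set => /=]; rewrite enorm_polar.
Qed.

Let excluded_exponent v :
  (lambda%:E * polar_mean (excluded v) = excl_mean lambda beta B ell v s r)%E.
Proof.
congr (_ * _)%E; apply: eq_integral => theta _.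
rewrite integral_mkcond [RHS]integral_mkcond; apply: eq_integral => t _.
rewrite !patchE -EFinM.
have tpos : (t \in `]0, +oo[%classic) = (0 < t).
  by apply/idP/idP => [/set_mem|t0]; [|apply/mem_set]; rewrite /= in_itv/= andbT.
have tin : (t \in [set t | 0 <= t%:E <= excl ell v s r]%E) = (0 <= t) && (t%:E <= excl ell v s r)%E.
  by apply/idP/idP => [/set_mem|H]; [|apply/mem_set]; rewrite /= lee_fin.
(* The radius 0 belongs to the domain of [excl_mean] but not to that of the polar integral; the
   factor [t] cancels it. *)
rewrite tpos tin le_eqVlt; have [t0|t0|<-] := ltgtP 0 t => //=; last first.
  by rewrite mulr0; case: ifP.
rewrite /excluded outside_polar; last exact: ltW.
have [te|te] := boolP (t%:E <= excl ell v s r)%E.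
  by rewrite ltNge te subr0 mulr1.
by rewrite ltNge te subrr mulr0 mul0r.
Qed.

(** Only the type probability depends on the angle. Tonelli exchanges angle and radius, and the
    remaining factors leave the angular integral. *)
Let interfering_exponent v :
  (lambda%:E * polar_mean (interfering v) =
   \int[mu]_(t in [set t | excl ell v s r <= t%:E])
      ((lambda * sir_factor tau (ell s r) (ell v t))%:E *
       (\int[mu]_(theta in `[0%R, (2 * pi)%R])
          (p_joint B s v r t theta / p_type beta s r)%:E) * t%:E))%E.
Proof.
set e := excl ell v s r.
have e0 : (0 <= e)%E by exact: excl_ge0.
have mtwopi : measurable (`[0, 2 * pi]%classic : set R) by exact: measurable_itv.
pose qt t theta : R := qh v (polar t theta) * \1_(`[0, 2 * pi]%classic : set R) theta.
have mqt : measurable_fun setT (fun x : plane R => (qt x.1 x.2)%:E).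
  apply/measurable_EFinP; apply: measurable_funM.
    exact: (measurableT_comp (measurable_qh v) (@measurable_polar R)).
  exact: (measurableT_comp (measurable_indic mtwopi) measurable_snd).
have qt0 x : (0 <= (qt x.1 x.2)%:E)%E by rewrite lee_fin mulr_ge0.
have mqtt t : measurable_fun setT (fun theta => (qt t theta)%:E).
  apply/measurable_EFinP; apply: measurable_funM; last exact: measurable_indic.
  apply: (measurableT_comp (measurable_qh v)); apply: measurable_plane.
    by apply: measurable_funM => //; exact: measurable_cos.
  by apply: measurable_funM => //; exact: measurable_sin.
pose angular t := (\int[mu]_theta (qt t theta)%:E)%E.
have mangular : measurable_fun setT angular.
  exact: (@measurable_fun_fubini_tonelli_F _ _ _ _ _ mu _ mqt qt0).
have angular0 t : (0 <= angular t)%E by apply: integral_ge0 => theta _; rewrite lee_fin mulr_ge0.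
have angularE t : angular t = (\int[mu]_(theta in `[0%R, (2 * pi)%R])
          (p_joint B s v r t theta / p_type beta s r)%:E)%E.
  rewrite [RHS]integral_mkcond; apply: eq_integral => theta _.
  by rewrite patchE /qt indicE; case: ifP => _; rewrite ?mulr1 ?mulr0.
pose mass t : R := lambda * sir v t * Num.max 0 t.
have mmass : measurable_fun setT mass.
  apply: measurable_funM; first exact: measurable_funM.
  exact: measurable_maxr.
have mass0 t : 0 <= mass t by rewrite !mulr_ge0 ?(ltW lambda_gt0)// le_max lexx.
pose tail : set R := [set t | (e < t%:E)%E].
have mtail : measurable tail.
  rewrite /tail; case: {+}e => [x| |].
  - rewrite (_ : [set _ | _] = `]x, +oo[%classic); first exact: measurable_itv.
    by apply/seteqP; split => t /=; rewrite in_itv/= andbT lte_fin.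
  - by rewrite (_ : [set _ | _] = set0)//; apply/seteqP; split.
  - by rewrite (_ : [set _ | _] = setT)//; apply/seteqP; split => // t _ /=; rewrite ltNyr.
pose G (x : plane R) : \bar R := ((\1_tail x.1 * mass x.1)%:E * (qt x.1 x.2)%:E)%E.
have mG : measurable_fun setT G.
  apply: emeasurable_funM => //; apply/measurable_EFinP.
  apply: (measurableT_comp (f := fun t => \1_tail t * mass t) _ measurable_fst).
  by apply: measurable_funM => //; exact: measurable_indic.
have G0 x : (0 <= G x)%E by rewrite mule_ge0// lee_fin mulr_ge0.
transitivity (\int[mu]_(t in tail) ((mass t)%:E * angular t))%E; last first.
  (* Serving requires strictly more than the exclusion radius, whereas [kappa] integrates from it
     onward: one null point apart if the radius is finite, both domains empty if it is infinite. *)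
  transitivity (\int[mu]_(t in [set t | e <= t%:E]%E) ((mass t)%:E * angular t))%E.
    rewrite /tail; case: {+}e e0 => [x x0|_|//].
    - have -> : [set t : R | (x%:E < t%:E)%E] = `]x, +oo[%classic.
        by apply/seteqP; split => t /=; rewrite in_itv/= andbT lte_fin.
      have -> : [set t : R | (x%:E <= t%:E)%E] = `[x, +oo[%classic.
        by apply/seteqP; split => t /=; rewrite in_itv/= andbT lee_fin.
      apply: integral_itv_obnd_cbnd; apply: measurable_funTS.
      by apply: emeasurable_funM => //; exact/measurable_EFinP.
    - have -> : [set t : R | (+oo < t%:E)%E] = set0 by apply/seteqP; split.
      by rewrite !integral_set0.
  apply: eq_integral => t /set_mem/= et.
  have t0 : 0 <= t by rewrite -lee_fin; exact: le_trans et.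
  rewrite -angularE /mass /sir max_r// -sir_factorE//; last exact: (pl_ge0 hell).
  by rewrite EFinM muleAC.
transitivity (\int[mu]_t \int[mu]_theta G (t, theta))%E; last first.
  rewrite [RHS]integral_mkcond; apply: eq_integral => t _.
  rewrite patchE /G/= ge0_integralZl_EFin//=; last 3 first.
  - by move=> theta _; rewrite lee_fin mulr_ge0.
  - exact: mqtt.
  - by rewrite mulr_ge0.
  by rewrite -/(angular t) indicE; case: ifP => _; rewrite ?mul1r ?mul0r ?mul0e.
rewrite (@fubini_tonelli _ _ _ _ _ mu mu G mG G0) -ge0_integral_pscale//; last first.
  move=> theta _; apply: integral_ge0 => t /=; rewrite in_itv/= andbT => t0.
  by rewrite mule_ge0// lee_fin// ltW.
rewrite integral_mkcond; apply: eq_integral => theta _.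
rewrite /fubini_G patchE; case: ifPn => thetaI; last first.
  by rewrite integral0_eq// => t _; rewrite /G/= /qt [\1_(`[0, 2 * pi]%classic) _]indicE (negbTE thetaI) mulr0 mule0.
rewrite -ge0_integral_pscale//; last first.
  move=> t /=; rewrite in_itv/= andbT => t0.
  by rewrite mule_ge0// lee_fin// ltW.
rewrite integral_mkcond; apply: eq_integral => t _.
rewrite patchE /G/= /qt [\1_(`[0, 2 * pi]%classic) theta]indicE thetaI mulr1.
have tpos : (t \in `]0, +oo[%classic) = (0 < t).
  by apply/idP/idP => [/set_mem|t0]; [|apply/mem_set]; rewrite /= in_itv/= andbT.
rewrite tpos; have [t_gt0|t_le0] := ltP 0 t; last first.
  have -> : \1_tail t = 0 :> R; last by rewrite mul0r mul0e.
  rewrite indicE memNset//= => et; have := le_lt_trans e0 et.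
  by rewrite lte_fin ltNge t_le0.
have t0 := ltW t_gt0.
rewrite -!EFinM /interfering outside_polar// enorm_polar//.
rewrite /mass [Num.max 0 t]max_r// indicE.
have -> : (t \in tail) = (excl ell v s r < t%:E)%E.
  by apply/idP/idP => [/set_mem|H]; [|apply/mem_set].
by congr EFin; ring.
Qed.

(** Minus the logarithm of [kappa] for the same [v], [s] and [r]. *)
Definition interference_exponent v : \bar R :=
  (\int[mu]_(t in [set t | excl ell v s r <= t%:E])
      ((lambda * sir_factor tau (ell s r) (ell v t))%:E *
       (\int[mu]_(theta in `[0%R, (2 * pi)%R])
          (p_joint B s v r t theta / p_type beta s r)%:E) * t%:E))%E.

Let polar_mean_ge0 (f : plane R -> R) : (forall z, 0 <= f z) -> (0 <= polar_mean f)%E.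
Proof.
move=> f0; apply: integral_ge0 => theta _; apply: integral_ge0 => t /=.
by rewrite in_itv/= andbT => t0; rewrite mule_ge0 ?lee_fin// ltW.
Qed.

Lemma interference_exponent_ge0 v : (0 <= interference_exponent v)%E.
Proof.
rewrite /interference_exponent -interfering_exponent mule_ge0 ?polar_mean_ge0//.
by rewrite lee_fin ltW.
Qed.

Lemma excl_mean_ge0 v : (0 <= excl_mean lambda beta B ell v s r)%E.
Proof. by rewrite -excluded_exponent mule_ge0 ?polar_mean_ge0// lee_fin ltW. Qed.

Lemma total_exponent : (forall z, q LoS z + q NLoS z = 1) ->
  (lambda%:E * \int[@area R]_z (1 - mean_retention beta B r N s ell tau z)%:E =
   (interference_exponent LoS + excl_mean lambda beta B ell LoS s r) +
   (interference_exponent NLoS + excl_mean lambda beta B ell NLoS s r))%E.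
Proof.
move=> q1; rewrite mean_retention_exponent// /interference_exponent.
rewrite -!interfering_exponent -!excluded_exponent.
have distr (a b a' b' : \bar R) : (0 <= a -> 0 <= b -> 0 <= a' -> 0 <= b' ->
    lambda%:E * ((a + b) + (a' + b')) =
    (lambda%:E * a + lambda%:E * b) + (lambda%:E * a' + lambda%:E * b'))%E.
  by move=> a0 b0 a'0 b'0; rewrite !ge0_muleDr// adde_ge0.
by apply: distr; exact: polar_mean_ge0.
Qed.

End exponent.

(** * Assembly of the closed formula *)

Lemma expeRN_add (R : realType) (x y : \bar R) : (0 <= x)%E -> (0 <= y)%E ->
  expeR (- (x + y)) = (expeR (- x) * expeR (- y))%E.
Proof. by move=> x0 y0; rewrite oppeD ?ge0_adde_def// expeRD. Qed.

Lemma mule_expeRN (R : realType) (k p a b a' b' : \bar R) :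
  (0 <= a)%E -> (0 <= b)%E -> (0 <= a')%E -> (0 <= b')%E ->
  (k * (p * expeR (- ((a + b) + (a' + b')))) =
   k * expeR (- a) * expeR (- a') * (p * expeR (- b - b')))%E.
Proof.
move=> a0 b0 a'0 b'0; rewrite expeRN_add ?adde_ge0// !expeRN_add// expeRD.
rewrite -!muleA; congr (_ * _)%E; rewrite [LHS]muleCA; congr (_ * _)%E.
by rewrite [RHS]muleCA; congr (_ * _)%E; rewrite muleCA.
Qed.

Lemma p_type_gt0 (R : realType) (beta : R) s (r : R) : 0 < beta -> 0 < r ->
  0 < p_type beta s r.
Proof.
move=> b0 r0; case: s => /=; first exact: expR_gt0.
by rewrite subr_gt0 -expR0 ltr_expR oppr_lt0 mulr_gt0.
Qed.

Section coverage_given.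
Context (R : realType) (lambda beta mu noise tau r : R)
  (nu : probability (measurableTypeR R) R) (ell : ltype -> R -> R)
  (B : segment_process R) (N : bs_network R).
Hypotheses (lambda_gt0 : 0 < lambda) (beta_gt0 : 0 < beta) (noise_gt0 : 0 < noise)
  (tau_gt0 : 0 < tau) (r_gt0 : 0 < r).
Hypotheses (hB : is_boolean_model mu nu B) (hell : is_path_loss ell)
  (law : first_order_law lambda beta B r N).

Lemma coverage_given (s : ltype) :
  bs_prob N [set w | [/\ given_type N w = s, serving ell N w &
                         (tau%:E < SINR ell noise N w)%E]] =
  ((noise_factor tau noise (ell s r))%:E *
   kappa lambda beta B ell tau LoS s r * kappa lambda beta B ell tau NLoS s r *
   serving_g lambda beta B ell s r)%E.
Proof.
have r_ge0 := ltW r_gt0.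
(* If [ell s r] vanishes, the SINR is 0 and the event is empty, in agreement with the convention in
   [noise_factor]. *)
have := pl_ge0 hell s r_ge0; rewrite le_eqVlt => /orP[/eqP ell0|ell_gt0].
  rewrite /noise_factor -ell0 eqxx !mul0e (_ : [set _ | _] = set0) ?measure0//.
  apply/seteqP; split => // w /= [ts _].
  rewrite /SINR ts (fo_given_pos law) -ell0 mulr0 mul0e lte_fin ltNge.
  by rewrite ltW.
have ps_gt0 : 0 < p_type beta s r by exact: p_type_gt0.
have msec v x := @measurable_has_type_section R B (bm_length_ge0 hB) (bm_meas_center hB)
  (bm_meas_length hB) (bm_meas_orient hB) v x.
have mprob v := @measurable_prob_types R B (bm_length_ge0 hB) (bm_meas_center hB)
  (bm_meas_length hB) (bm_meas_orient hB) s v (polar r 0).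
have mq v := @measurable_type_prob R beta r B N s mprob v.
have qsum := type_prob_sum law ps_gt0 mq msec.
rewrite (serving_coverage_probability law hell lambda_gt0 noise_gt0 tau_gt0
  ps_gt0 ell_gt0 mq qsum).
rewrite (total_exponent hell lambda_gt0 tau_gt0 r_ge0 ps_gt0 ell_gt0 mprob qsum).
have I0 v : (0 <= interference_exponent lambda beta tau r B s ell v)%E.
  exact: (interference_exponent_ge0 hell lambda_gt0 tau_gt0 r_ge0 ps_gt0 ell_gt0 mprob).
have M0 v : (0 <= excl_mean lambda beta B ell v s r)%E.
  exact: excl_mean_ge0.
have -> : noise_factor tau noise (ell s r) = expR (- (tau * noise / ell s r)).
  by rewrite /noise_factor gt_eqF.
exact: mule_expeRN (I0 LoS) (M0 LoS) (I0 NLoS) (M0 NLoS).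
Qed.

End coverage_given.

Theorem theorem5 (R : realType) (lambda mu noise tau : R)
    (nu : probability (measurableTypeR R) R)
    (ell : ltype -> R -> R)
    (B : segment_process R) (Q : R -> bs_network R)
    (lambda_gt0 : 0 < lambda) (mu_gt0 : 0 < mu)
    (mean_length : (0 < \int[nu]_l l%:E < +oo)%E)
    (hB : is_boolean_model mu nu B)
    (hell : is_path_loss ell)
    (noise_gt0 : 0 < noise) (tau_gt0 : 0 < tau)
    (hQ : forall r, 0 < r ->
       first_order_law lambda (blockage_beta mu nu) B r (Q r)) :
  coverage lambda noise ell Q tau =
  (\sum_(s <- [:: LoS; NLoS])
     \int[@lebesgue_measure R]_(r in `]0%R, +oo[)
       ((2 * pi * lambda)%:E * (noise_factor tau noise (ell s r))%:E *
        kappa lambda (blockage_beta mu nu) B ell tau LoS s r *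
        kappa lambda (blockage_beta mu nu) B ell tau NLoS s r *
        serving_g lambda (blockage_beta mu nu) B ell s r * r%:E))%E.
Proof.
(* Positivity of [beta] makes both types of the given station possible at every [r > 0], so that
   conditioning on either is legitimate. *)
have beta_gt0 : 0 < blockage_beta mu nu.
  rewrite /blockage_beta divr_gt0 ?pi_gt0// !mulr_gt0// fine_gt0//.
rewrite /coverage; apply: eq_bigr => s _.
rewrite -ge0_integral_pscale; last 2 first.
- by rewrite !mulr_gt0// pi_gt0.
- move=> r /=; rewrite in_itv/= andbT => r0.
  by rewrite mule_ge0// lee_fin ltW.
apply: eq_integral => r /set_mem/=; rewrite in_itv/= andbT => r0.
rewrite (coverage_given lambda_gt0 beta_gt0 noise_gt0 tau_gt0 r0 hB hell (hQ r r0)).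
have assoc (a b b' b'' c d : \bar R) :
  (a * ((b * b' * b'' * c) * d) = a * b * b' * b'' * c * d)%E by rewrite !muleA.
exact: assoc.
Qed.
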